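(* Let $\mathbb{K}=\mathbb{Q}[\omega]$ with $\omega$ a primitive third root of unity, $W=\bigwedge^3_{\mathbb{K}}\mathbb{K}^6$, and let $t:W\to W$ be the $\mathbb{K}$-antilinear automorphism $t=\rho^{-1}\circ\tau$ defined in the context. Let $V_+\subset\mathbb{C}^6$ be a 3-dimensional complex subspace on which $H$ is positive definite, with associated complex structure $J=J_{V_+}$, $V^{1,0}=V_+$, $V^{0,1}=V_+^\perp$, and representation $h_3$ on $W\otimes_{\mathbb{Q}}\mathbb{R}$. Then: 1. $t^2=\mathrm{Id}$, and with $W_{\pm}=\ker(t\mp\mathrm{Id})$ one has $W=W_+\oplus W_-$ and $\dim_{\mathbb{Q}}W_+=\dim_{\mathbb{Q}}W_-=20$. 2. $t\circ h_3(z)=h_3(z)\circ t$ for all $z\in\mathbb{C}^*$ (with $t$ extended $\mathbb{R}$-linearly), so $h_3$ preserves $W_\pm\otimes_{\mathbb{Q}}\mathbb{R}$ and $W_+$, $W_-$ are rational Hodge structures of weight $3$. 3. Multiplication by $2\omega+1\in\mathbb{K}$ on $W$ restricts to an isomorphism of Hodge structures $W_+\to W_-$. 4. The natural map $W_+\otimes_{\mathbb{Q}}\mathbb{C}\to W\otimes_{\mathbb{Q}}\mathbb{R}=\bigwedge^3\mathbb{C}^6$, $w\otimes z\mapsto zw$, is an isomorphism, and under it $$(W_{+,\mathbb{C}})^{p,q}=\bigwedge^pV^{1,0}\otimes\bigwedge^qV^{0,1}\qquad(p+q=3).$$ In particular $W_+$ is a Hodge structure of Calabi-Yau type with Hodge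 numbers $(h^{3,0},h^{2,1},h^{1,2},h^{0,3})=(1,9,9,1)$.
   Context: Fix an embedding $\mathbb{K}\subset\mathbb{C}$, so $\mathbb{K}^6\otimes_{\mathbb{Q}}\mathbb{R}=\mathbb{C}^6$ and $W\otimes_{\mathbb{Q}}\mathbb{R}=\bigwedge^3_{\mathbb{C}}\mathbb{C}^6$. Hermitian form: $H(v,w)=\sum_{j=1}^6\epsilon_j\overline{v_j}w_j$ on $\mathbb{K}^6$ (and on $\mathbb{C}^6$), with $\epsilon_1=\epsilon_2=\epsilon_3=1$, $\epsilon_4=\epsilon_5=\epsilon_6=-1$. It induces $\widetilde H$ on $W$, $\mathbb{K}$-antilinear in the first and $\mathbb{K}$-linear in the second variable, with $\widetilde H(a_1\wedge a_2\wedge a_3,p_1\wedge p_2\wedge p_3)=\det\big(H(a_r,p_s)\big)_{r,s=1}^3$. Maps: $\tau:W\to\mathrm{Hom}_{\mathbb{K}}(W,\mathbb{K})$, $\tau(\alpha)=[\beta\mapsto\widetilde H(\alpha,\beta)]$ ($\mathbb{K}$-antilinear); $\rho:W\to\mathrm{Hom}_{\mathbb{K}}(W,\mathbb{K})$, $\rho(\alpha)=[\beta\mapsto\gamma(\alpha\wedge\beta)]$, a $\mathbb{K}$-linear isomorphism, where $\gamma:\bigwedge^6_{\mathbb{K}}\mathbb{K}^6\to\mathbb{K}$ is the isomorphism sending $e_1\wedge\cdots\wedge e_6$ to $1$ ($e_i$ the standard basis). Complex structure: for $V_+$ as in the claim, $V_-=V_+^\perp$ with respect to $H$ and $J=J_{V_+}$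 is the $\mathbb{C}$-linear map of $\mathbb{C}^6=V_+\oplus V_-$ acting as $i$ on $V_+$ and $-i$ on $V_-$. Put $h(a+bi)=a\,\mathrm{Id}+bJ$ and $h_3(z)(u\wedge v\wedge w)=h(z)u\wedge h(z)v\wedge h(z)w$. A representation of $\mathbb{C}^*$ on $U\otimes_{\mathbb{Q}}\mathbb{R}$ ($U$ a $\mathbb{Q}$-vector space) defines a Hodge structure of weight $3$ on $U$ when $U\otimes_{\mathbb{Q}}\mathbb{C}$ is the direct sum, over $p+q=3$, of the subspaces $U^{p,q}$ on which $z\in\mathbb{C}^*$ acts as $z^p\bar z^q$. The space $\bigwedge^pV^{1,0}\otimes\bigwedge^qV^{0,1}$ is viewed inside $\bigwedge^3\mathbb{C}^6$ via the wedge product. *)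

(* Defs.v *)
From HB Require Import structures.
From mathcomp Require Import all_boot all_order all_algebra all_field.
From mathcomp Require Import complex reals ring.
From mathcomp Require boolp classical_sets.

Set Implicit Arguments.
Unset Strict Implicit.
Unset Printing Implicit Defensive.

Import Order.TTheory GRing.Theory Num.Theory.
Local Open Scope ring_scope.

Definition ksub (n k : nat) := {S : {set 'I_n} | #|S| == k}.

(** [\bigwedge^k F^n]: [a] stands for the sum of the [a S] [e_S], where
    [e_S] is the wedge of the [e_i], [i \in S], taken in increasing order.
    [F] may be replaced by a convertible type ([F^o], [Rcomplex R]) in order to
    select the field over which this is regarded as a vector space. *)
Definition ext (F : Type) (n k : nat) := {ffun ksub n k -> F}.

Section Wedge.
Variables (F : comNzRingType) (n : nat).

(** [e_S] wedge [e_T] is this sign times [e_(S :|: T)] for disjoint [S], [T]. *)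
Definition shuffle_sign (S T : {set 'I_n}) : F :=
  (-1) ^+ #|[set x : 'I_n * 'I_n | [&& x.1 \in S, x.2 \in T & (x.2 < x.1)%N]]|.

(** Disjointness of [S] and [T] is forced by the cardinality of the union. *)
Definition wedge k l (a : ext F n k) (b : ext F n l) : ext F n (k + l) :=
  [ffun U : ksub n (k + l) => \sum_(S : ksub n k) \sum_(T : ksub n l | val S :|: val T == val U)
     shuffle_sign (val S) (val T) * (a S * b T)].

Definition ext1 (v : 'rV[F]_n) : ext F n 1 :=
  [ffun S : ksub n 1 => \sum_(i in val S) v 0 i].

Definition wedge3 (u v w : 'rV[F]_n) : ext F n 3 :=
  wedge (wedge (ext1 u) (ext1 v)) (ext1 w).

(** The [r]-th element of [S] in increasing order. *)
Definition elt k (S : ksub n k) (r : 'I_k) : 'I_n :=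
  enum_val (cast_ord (esym (eqP (valP S))) r).

Definition bvec k (S : ksub n k) (r : 'I_k) : 'rV[F]_n := delta_mx 0 (elt S r).

(** The linear map on [\bigwedge^3 F^n] induced by an alternating trilinear map
    [phi]; see [lift3_wedge3]. *)
Definition lift3 (M : lmodType F) (phi : 'rV[F]_n -> 'rV[F]_n -> 'rV[F]_n -> M)
    (a : ext F n 3) : M :=
  \sum_S a S *: phi (bvec S ord0) (bvec S (lift ord0 ord0)) (bvec S ord_max).

Definition fullS : ksub n n := exist _ [set: 'I_n] (introT eqP (etrans (cardsT _) (card_ord n))).

Definition gamma (a : ext F n n) : F := a fullS.

End Wedge.

Section WedgeFacts.
Variables (F : comNzRingType) (n : nat).

Definition sing (i : 'I_n) : ksub n 1 := exist _ [set i] (introT eqP (cards1 i)).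

Lemma big_ksub1 (M : nmodType) (P : pred (ksub n 1)) (G : ksub n 1 -> M) :
  \sum_(S | P S) G S = \sum_(i | P (sing i)) G (sing i).
Proof.
apply: (reindex sing); apply: onW_bij; apply: inj_card_bij.
  by move=> i j /(congr1 val) /= /set1_inj.
rewrite card_ord (card_sig (fun S : {set 'I_n} => #|S| == 1)) -[X in (_ <= X)%N]bin1.
by rewrite -[X in 'C(X, 1)]card_ord -card_draws cardsE.
Qed.

Lemma ext1_sing (v : 'rV[F]_n) i : ext1 v (sing i) = v 0 i.
Proof. by rewrite ffunE big_set1. Qed.

Definition sgn3 (i j k : 'I_n) : F :=
  (-1) ^+ (j < i)%N * (-1) ^+ ((k < i) + (k < j))%N.

Lemma shuffle_signE (S T : {set 'I_n}) :
  shuffle_sign F S T = (-1) ^+ (\sum_(a in S) \sum_(b in T) (b < a))%N.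
Proof.
rewrite /shuffle_sign; congr (_ ^+ _); rewrite -sum1_card.
rewrite pair_big_dep /= [RHS](bigID (fun x : 'I_n * 'I_n => (x.2 < x.1)%N)) /=.
rewrite [X in (_ + X)%N]big1 ?addn0; last by move=> x /andP[_ /negbTE ->].
apply: eq_big => [x|x]; first by rewrite inE andbA.
by rewrite inE => /and3P[_ _ ->].
Qed.

Lemma wedge3E (u v w : 'rV[F]_n) (U : ksub n 3) :
  wedge3 u v w U = \sum_i \sum_j \sum_k
    (if (i != j) && ([set i; j] :|: [set k] == val U)
     then sgn3 i j k else 0) * (u 0 i * v 0 j * w 0 k).
Proof.
rewrite ffunE.
transitivity (\sum_i \sum_j \sum_(T : ksub n 2 | [set i] :|: [set j] == val T)
  \sum_(k | val T :|: [set k] == val U)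
  shuffle_sign F [set i] [set j] * shuffle_sign F (val T) [set k] *
    (u 0 i * v 0 j * w 0 k)).
  under [RHS]eq_bigr do rewrite (exchange_big_dep xpredT) //=.
  rewrite [RHS]exchange_big /=; apply: eq_bigr => T _.
  rewrite big_ksub1 /=.
  under eq_bigr => k _.
    rewrite ffunE ext1_sing big_ksub1 mulrA mulrC !mulr_sumr.
    under eq_bigr => i _.
      rewrite big_ksub1 /= !mulr_sumr.
      under eq_bigr => j _ do rewrite !ext1_sing.
      over.
    over.
  rewrite exchange_big /=; apply: eq_bigr => i _.
  rewrite exchange_big /=; apply: eq_bigr => j _.
  by apply: eq_bigr => k _; ring.
apply: eq_bigr => i _; apply: eq_bigr => j _.
have [->|nij] /= := eqVneq i j.
  rewrite [LHS]big_pred0 => [|T]; first by rewrite big1 // => k _; rewrite mul0r.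
  by apply/eqP => /(congr1 (fun A : {set _} => #|A|)); rewrite setUid cards1 (eqP (valP T)).
have h2 : #|[set i; j]| == 2 by rewrite cards2 nij.
rewrite (big_pred1 (exist (fun S : {set _} => #|S| == 2) _ h2 : ksub n 2)) => [|T] /=; last first.
  by rewrite eq_sym -val_eqE.
rewrite big_mkcond /=; apply: eq_bigr => k _; case: ifP => _; last by rewrite mul0r.
rewrite /sgn3 !shuffle_signE !big_set1 big_setU1 ?inE //= !big_set1.
by [].
Qed.

Lemma enum_ksub3 (U : ksub n 3) (a b c : 'I_n) :
  (a < b)%N -> (b < c)%N -> val U = [set a; b; c] -> enum (val U) = [:: a; b; c].
Proof.
move=> ab bc UE.
apply: (@irr_sorted_eq _ (relpre val ltn)) => /=.
- by move=> x y z /=; apply: ltn_trans.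
- by move=> x /=; rewrite ltnn.
- rewrite {1}/enum_mem; apply: sorted_filter; first by move=> x y z /=; apply: ltn_trans.
  by rewrite -enumT -(sorted_map (e' := ltn) (f := val)) val_enum_ord iota_ltn_sorted.
- by rewrite ab bc.
- by move=> x; rewrite mem_enum UE !inE orbA.
Qed.

Lemma bvec_ksub3 (U : ksub n 3) (a b c : 'I_n) :
  (a < b)%N -> (b < c)%N -> val U = [set a; b; c] ->
  [/\ bvec F U ord0 = delta_mx 0 a, bvec F U (lift ord0 ord0) = delta_mx 0 b
    & bvec F U ord_max = delta_mx 0 c].
Proof.
move=> ab bc UE; have E := enum_ksub3 ab bc UE.
by split; congr delta_mx; rewrite /elt (enum_val_nth a) E.
Qed.

Section Lift.
Variables (cj : {rmorphism F -> F}) (M : lmodType F).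
Variable phi : 'rV[F]_n -> 'rV[F]_n -> 'rV[F]_n -> M.
Hypothesis lin1 : forall a u u' v w,
  phi (a *: u + u') v w = cj a *: phi u v w + phi u' v w.
Hypothesis lin2 : forall a u v v' w,
  phi u (a *: v + v') w = cj a *: phi u v w + phi u v' w.
Hypothesis lin3 : forall a u v w w',
  phi u v (a *: w + w') = cj a *: phi u v w + phi u v w'.
Hypothesis alt12 : forall u w, phi u u w = 0.
Hypothesis alt23 : forall u v, phi u v v = 0.

Lemma phiN12 u v w : phi v u w = - phi u v w.
Proof.
have D1 x y : phi (x + y) = fun v w => phi x v w + phi y v w.
  by apply: boolp.funext => ?; apply: boolp.funext => ?; rewrite -[x]scale1r lin1 rmorph1 !scale1r.
have D2 z x y : phi z (x + y) = fun w => phi z x w + phi z y w.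
  by apply: boolp.funext => ?; rewrite -[x]scale1r lin2 rmorph1 !scale1r.
have := alt12 (u + v) w; rewrite D1 !D2 !alt12 add0r addr0 => /eqP.
by rewrite addrC addr_eq0 => /eqP.
Qed.

Lemma phiN23 u v w : phi u w v = - phi u v w.
Proof.
have D2 z x y : phi z (x + y) = fun w => phi z x w + phi z y w.
  by apply: boolp.funext => ?; rewrite -[x]scale1r lin2 rmorph1 !scale1r.
have D3 z t x y : phi z t (x + y) = phi z t x + phi z t y.
  by rewrite -[x]scale1r lin3 rmorph1 !scale1r.
have := alt23 u (v + w); rewrite D2 !D3 !alt23 add0r addr0 => /eqP.
by rewrite addrC addr_eq0 => /eqP.
Qed.

Lemma phi_sum u v w : phi u v w = \sum_i \sum_j \sum_k
  cj (u 0 i * v 0 j * w 0 k) *: phi (delta_mx 0 i) (delta_mx 0 j) (delta_mx 0 k).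
Proof.
have E (f : 'rV[F]_n -> M) (fL : forall a x y, f (a *: x + y) = cj a *: f x + f y) x :
    f x = \sum_i cj (x 0 i) *: f (delta_mx 0 i).
  have f0 : f 0 = 0.
    have := fL 1 0 0; rewrite scale1r addr0 rmorph1 scale1r => /eqP.
    by rewrite -subr_eq0 opprD addrA subrr sub0r oppr_eq0 => /eqP.
  rewrite {1}[x]row_sum_delta.
  by elim/big_rec2 : _ => [//|i y z _ <-]; rewrite fL.
rewrite (E (fun u => phi u v w)) //; apply: eq_bigr => i _.
rewrite (E (fun v => phi _ v w)) // scaler_sumr; apply: eq_bigr => j _.
rewrite (E (fun w => phi _ _ w)) // !scaler_sumr; apply: eq_bigr => k _.
by rewrite !scalerA !rmorphM ?mulrA.
Qed.

Lemma phi_basis i j k :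
  \sum_(U : ksub n 3) (if (i != j) && ([set i; j] :|: [set k] == val U)
     then sgn3 i j k else 0) *:
    phi (bvec F U ord0) (bvec F U (lift ord0 ord0)) (bvec F U ord_max)
  = phi (delta_mx 0 i) (delta_mx 0 j) (delta_mx 0 k).
Proof.
have [->|nij] /= := eqVneq i j.
  by rewrite alt12 big1 // => U _; rewrite scale0r.
have [kij|nk] := boolP (k \in [set i; j]).
  rewrite big1 => [|U _]; last first.
    rewrite [_ :|: _](setUidPl _) ?sub1set //; case: eqP => [E|]; last by rewrite scale0r.
    by have := valP U; rewrite /= -E cards2 nij.
  move: kij; rewrite !inE => /orP[]/eqP ->; last by rewrite alt23.
  by rewrite phiN23 alt12 oppr0.
have h3 : #|[set i; j] :|: [set k]| == 3 by rewrite setUC cardsU1 nk cards2 nij.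
rewrite (bigD1 (exist (fun S : {set _} => #|S| == 3) _ h3 : ksub n 3)) //= eqxx [X in _ + X]big1 => [|U nU]; last first.
  by case: eqP => [E|]; rewrite ?scale0r //; move: nU; rewrite -val_eqE /= E eqxx.
set U : ksub n 3 := exist _ _ _; rewrite addr0.
have key (a b c : 'I_n) : (a < b)%N -> (b < c)%N ->
    [set i; j] :|: [set k] = [set a; b; c] ->
    phi (bvec F U ord0) (bvec F U (lift ord0 ord0)) (bvec F U ord_max)
    = phi (delta_mx 0 a) (delta_mx 0 b) (delta_mx 0 c).
  by move=> ab bc /(bvec_ksub3 (U := U) ab bc)[-> -> ->].
move: nk; rewrite !inE negb_or => /andP[nki nkj].
rewrite /sgn3.
have [ij|ji|/val_inj E] := ltngtP i j; last by rewrite E eqxx in nij.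
- have [kj|jk|/val_inj E] := ltngtP k j; last by rewrite E eqxx in nkj.
  + have [ki|ik|/val_inj E] := ltngtP k i; last by rewrite E eqxx in nki.
    * have Es : [set i; j] :|: [set k] = [set k; i; j].
        by apply/setP => x; rewrite !inE; case: (x == i); case: (x == j); case: (x == k).
      rewrite (key k i j ki ij Es).
      by rewrite phiN12 phiN23 opprK mul1r expr2 mulrNN mulr1 scale1r.
    * have Es : [set i; j] :|: [set k] = [set i; k; j].
        by apply/setP => x; rewrite !inE; case: (x == i); case: (x == j); case: (x == k).
      rewrite (key i k j ik kj Es).
      by rewrite phiN23 mul1r expr1 scaleN1r opprK.
  + have ik := ltn_trans ij jk; rewrite ltnNge (ltnW ik) /=.
    by rewrite (key i j k ij jk (erefl _)) mul1r scale1r.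
- have [ki|ik|/val_inj E] := ltngtP k i; last by rewrite E eqxx in nki.
  + have [kj|jk|/val_inj E] := ltngtP k j; last by rewrite E eqxx in nkj.
    * have Es : [set i; j] :|: [set k] = [set k; j; i].
        by apply/setP => x; rewrite !inE; case: (x == i); case: (x == j); case: (x == k).
      rewrite (key k j i kj ji Es).
      rewrite phiN23 phiN12 phiN23 ?opprK expr1 expr2 mulrNN mulr1 mulN1r ?mulr1.
      by rewrite scaleN1r opprK.
    * have Es : [set i; j] :|: [set k] = [set j; k; i].
        by apply/setP => x; rewrite !inE; case: (x == i); case: (x == j); case: (x == k).
      rewrite (key j k i jk ki Es).
      by rewrite phiN23 phiN12 opprK expr1 mulrNN mulr1 scale1r.
  + have jk := ltn_trans ji ik; rewrite ltnNge (ltnW jk) /=.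
    have Es : [set i; j] :|: [set k] = [set j; i; k].
        by apply/setP => x; rewrite !inE; case: (x == i); case: (x == j); case: (x == k).
      rewrite (key j i k ji ik Es).
    by rewrite phiN12 mulr1 expr1 scaleN1r opprK.
Qed.

Lemma lift_core u v w :
  \sum_(U : ksub n 3) cj (wedge3 u v w U) *:
    phi (bvec F U ord0) (bvec F U (lift ord0 ord0)) (bvec F U ord_max)
  = phi u v w.
Proof.
rewrite phi_sum.
under eq_bigr => U _.
  rewrite wedge3E rmorph_sum scaler_suml.
  under eq_bigr => i _.
    rewrite rmorph_sum scaler_suml.
    under eq_bigr => j _.
      rewrite rmorph_sum scaler_suml.
      over.
    over.
  over.
rewrite exchange_big /=; apply: eq_bigr => i _.
rewrite exchange_big /=; apply: eq_bigr => j _.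
rewrite exchange_big /=; apply: eq_bigr => k _.
rewrite -phi_basis scaler_sumr; apply: eq_bigr => U _.
rewrite rmorphM mulrC -scalerA; congr (_ *: (_ *: _)).
by case: ifP; rewrite ?rmorph0 // /sgn3 rmorphM !rmorph_sign.
Qed.

End Lift.

End WedgeFacts.

Lemma lift3_wedge3 (F : comNzRingType) n (M : lmodType F)
    (phi : 'rV[F]_n -> 'rV[F]_n -> 'rV[F]_n -> M) :
  (forall v w, linear (fun u => phi u v w)) ->
  (forall u w, linear (fun v => phi u v w)) ->
  (forall u v, linear (phi u v)) ->
  (forall u w, phi u u w = 0) -> (forall u v, phi u v v = 0) ->
  forall u v w, lift3 phi (wedge3 u v w) = phi u v w.
Proof.
move=> l1 l2 l3 a1 a2 u v w.
exact: (@lift_core _ _ idfun _ phi (fun a u u' v w => l1 v w a u u')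
  (fun a u v v' w => l2 u w a v v') (fun a u v w w' => l3 u v a w w')).
Qed.


Section HermitianForm.
Variables (F : fieldType) (cj : F -> F).

Definition eps (j : 'I_6) : F := if (j < 3)%N then 1 else -1.

Definition hform (v w : 'rV[F]_6) : F := \sum_j eps j * cj (v 0 j) * w 0 j.

(** The determinant formula on the basis, extended antilinearly in the first
    and linearly in the second variable; see [hform3_wedge3]. *)
Definition hform3 (a b : ext F 6 3) : F :=
  \sum_S \sum_T cj (a S) * b T *
    \det (\matrix_(r < 3, s < 3) hform (bvec F S r) (bvec F T s)).

Definition tau (a : ext F 6 3) : 'Hom(ext F^o 6 3, F^o) :=
  linfun (hform3 a : ext F^o 6 3 -> F^o).

Definition rho : 'Hom(ext F^o 6 3, 'Hom(ext F^o 6 3, F^o)) :=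
  linfun (fun a : ext F^o 6 3 =>
    linfun ((fun b => gamma (wedge (a : ext F 6 3) (b : ext F 6 3)))
              : ext F^o 6 3 -> F^o)).

Definition tmap (a : ext F 6 3) : ext F 6 3 := (rho^-1)%VF (tau a).

End HermitianForm.

Lemma det2E (F : comNzRingType) (A : 'M[F]_2) :
  \det A = A ord0 ord0 * A ord_max ord_max - A ord0 ord_max * A ord_max ord0.
Proof.
have E : lift ord0 ord0 = ord_max :> 'I_2 by apply: val_inj.
have E' : lift ord_max ord0 = ord0 :> 'I_2 by apply: val_inj.
rewrite (expand_det_row _ ord0) !big_ord_recl big_ord0 /cofactor !det_mx11 !mxE.
by rewrite !ord1 !E E' /= addn0 expr0 expr1; ring.
Qed.

Lemma det3E (F : comNzRingType) (f : 'I_3 -> 'I_3 -> F) :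
  let i0 : 'I_3 := ord0 in let i1 : 'I_3 := lift ord0 ord0 in
  let i2 : 'I_3 := ord_max in
  \det (\matrix_(i, j) f i j) =
      f i0 i0 * (f i1 i1 * f i2 i2 - f i1 i2 * f i2 i1)
    - f i0 i1 * (f i1 i0 * f i2 i2 - f i1 i2 * f i2 i0)
    + f i0 i2 * (f i1 i0 * f i2 i1 - f i1 i1 * f i2 i0).
Proof.
move=> i0 i1 i2.
have E : lift ord0 (lift ord0 ord0) = i2 :> 'I_3 by apply: val_inj.
have e0 : lift i1 ord0 = i0 :> 'I_3 by apply: val_inj.
have e1 : lift i1 ord_max = i2 :> 'I_3 by apply: val_inj.
have e2 : lift i2 ord0 = i0 :> 'I_3 by apply: val_inj.
have e3 : lift i2 ord_max = i1 :> 'I_3 by apply: val_inj.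
have e4 : lift ord0 ord_max = i2 :> 'I_3 by apply: val_inj.
rewrite (expand_det_row _ ord0) !big_ord_recl big_ord0 /cofactor !det2E !mxE.
rewrite !E -/i1 -/i0 -/i2 !e0 !e1 !e2 !e3 !e4 /=.
by rewrite /bump /=; ring.
Qed.

Lemma hformDl (F : fieldType) (cj : {rmorphism F -> F}) a u v w :
  hform cj (a *: u + v) w = cj a * hform cj u w + hform cj v w.
Proof.
rewrite /hform mulr_sumr -big_split /=; apply: eq_bigr => i _.
by rewrite !mxE rmorphD rmorphM; ring.
Qed.

Lemma hformDr (F : fieldType) (cj : {rmorphism F -> F}) a u v w :
  hform cj w (a *: u + v) = a * hform cj w u + hform cj w v.
Proof.
rewrite /hform mulr_sumr -big_split /=; apply: eq_bigr => i _.
by rewrite !mxE; ring.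
Qed.

Lemma hform3_wedge3 (F : fieldType) (cj : {rmorphism F -> F})
    (a1 a2 a3 p1 p2 p3 : 'rV[F]_6) :
  hform3 cj (wedge3 a1 a2 a3) (wedge3 p1 p2 p3) =
  \det (\matrix_(r < 3, s < 3)
    hform cj (nth 0 [:: a1; a2; a3] r) (nth 0 [:: p1; p2; p3] s)).
Proof.
pose phi (b1 b2 b3 q1 q2 q3 : 'rV[F]_6) : F^o := \det (\matrix_(r < 3, s < 3)
    hform cj (nth 0 [:: b1; b2; b3] r) (nth 0 [:: q1; q2; q3] s)).
rewrite -/(phi a1 a2 a3 p1 p2 p3).
rewrite -(@lift_core _ 6 cj F^o (fun b1 b2 b3 => phi b1 b2 b3 p1 p2 p3));
  rewrite /phi /=; try by move=> *; rewrite !det3E /= ?hformDl /GRing.scale /=; ring.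
apply: eq_bigr => S _.
pose psi q1 q2 q3 := phi (bvec F S ord0) (bvec F S (lift ord0 ord0)) (bvec F S ord_max) q1 q2 q3.
rewrite -/(phi _ _ _ _ _ _) -/(psi p1 p2 p3).
rewrite -(@lift_core _ 6 idfun F^o psi);
  rewrite /psi /phi /=; try by move=> *; rewrite !det3E /= ?hformDr /GRing.scale /=; ring.
rewrite scaler_sumr; apply: eq_bigr => T _.
rewrite -mulrA; congr (_ * (_ * \det _)).
apply/matrixP => r s; rewrite !mxE.
have E k (U : ksub 6 k) (i j : 'I_k) : i = j :> nat -> bvec F U i = bvec F U j.
  by move=> /val_inj ->.
by case: r => [[|[|[|//]]] ?]; case: s => [[|[|[|//]]] ?] /=;
  congr hform; apply: E.
Qed.

(** Complex conjugation restricted to a field [K] embedded in [R[i]]: the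
    element of [K] with image the conjugate of the image of [x]; it exists for
    the field used here by [conjKP]. *)
Definition conjK (R : realType) (K : fieldExtType rat)
    (iota : {rmorphism K -> R[i]}) (x : K) : K :=
  classical_sets.xget 0 (fun y => iota y = conjc (iota x)).

Lemma conjKP (R : realType) (K : fieldExtType rat)
    (iota : {rmorphism K -> R[i]}) (omega : K) :
  3.-primitive_root omega -> <<1; omega>>%VS = {:K}%VS ->
  forall x, iota (conjK iota x) = conjc (iota x).
Proof.
move=> omega3 gen x; apply: (@classical_sets.xgetPex _ 0 (fun y => iota y = conjc (iota x))).
have o3 : omega ^+ 3 = 1 by apply: prim_expr_order.
have co : conjc (iota omega) = iota (omega ^+ 2).
  have i3 : iota omega ^+ 3 = 1 by rewrite -rmorphXn o3 rmorph1.
  have n1 : `|iota omega| = 1.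
    by apply/eqP; rewrite -(@pexpr_eq1 _ _ 3) // -normrX i3 normr1.
  have nz : iota omega != 0 by rewrite -normr_gt0 n1.
  apply: (mulfI nz); rewrite -rmorphM -exprS o3 rmorph1.
  by rewrite -[conjc _]/(Num.conj _) -normCK n1 expr1n.
have : x \in <<1; omega>>%VS by rewrite gen memvf.
case/Fadjoin_polyP => p /polyOver1P[q ->] ->.
exists (map_poly (in_alg K) q).[omega ^+ 2] => /=.
rewrite -[conjc _]/((@conjc R \o iota) _) -!horner_map /= -!map_poly_comp -?co.
congr horner; apply: eq_map_poly => a /=.
transitivity (ratr a : R[i]); first exact: (fmorph_eq_rat (iota \o in_alg K)).
exact/esym/(fmorph_eq_rat ((@conjc R \o iota) \o in_alg K)).
Qed.

Section EigenSpaces.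
Variables (R : realType) (K : fieldExtType rat) (iota : {rmorphism K -> R[i]}).

Definition tW : ext K 6 3 -> ext K 6 3 := tmap (conjK iota).

Definition Wplus : {vspace ext K 6 3} := lker (linfun tW - \1)%VF.
Definition Wminus : {vspace ext K 6 3} := lker (linfun tW + \1)%VF.

End EigenSpaces.

Section Tensor.
Variables (F : numFieldType) (U : vectType rat).

(** [U \otimes_rat F], in coordinates with respect to [vbasis {:U}]. *)
Definition tens := 'rV[F]_(\dim {:U}).

Definition tensor (u : U) (z : F) : tens :=
  \row_i (ratr (coord (vbasis {:U}) i u) * z).

(** The [F]-linear map sending [tensor u z] to [z *: j u], for [j] linear over
    [rat]; see [tens_extE]. *)
Definition tens_ext (E : lmodType F) (j : U -> E) (x : tens) : E :=
  \sum_i x 0 i *: j (vbasis {:U})`_i.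

End Tensor.

Lemma linfunE (F : nzRingType) (U V : vectType F) (f : U -> V) :
  linear f -> linfun f =1 f.
Proof.
move=> fL.
pose g : {linear U -> V} := HB.pack f (GRing.isLinear.Build F U V *:%R f fL).
exact: (lfunE g).
Qed.

Lemma tens_ext_linear (F : numFieldType) (U : vectType rat) (E : lmodType F)
  (j : U -> E) : linear (tens_ext j).
Proof.
move=> a x y; rewrite /tens_ext scaler_sumr -big_split /=; apply: eq_bigr => i _.
by rewrite !mxE scalerDl scalerA.
Qed.

Lemma tens_extE (F : numFieldType) (U : vectType rat) (E : lmodType F) (j : U -> E) :
  {morph j : u v / u + v} -> (forall a u, j (a *: u) = ratr a *: j u) ->
  forall u z, tens_ext j (tensor u z) = z *: j u.
Proof.
move=> jD jZ u z; rewrite /tens_ext {2}(coord_vbasis (memvf u)).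
have j0 : j 0 = 0 by rewrite -(scale0r (0 : U)) jZ rmorph0 scale0r.
rewrite (big_morph j jD j0) scaler_sumr; apply: eq_bigr => i _.
by rewrite mxE jZ scalerA mulrC.
Qed.

Definition tens_map (F : numFieldType) (U V : vectType rat) (f : U -> V) :
    tens F U -> tens F V :=
  tens_ext (fun u => tensor (f u) 1).

Section Hodge.
Variable R : realType.

(** The [R[i]]-linear extension of an [R]-linear endomorphism. *)
Definition complexify n (f : 'End('rV[R]_n)) (x : 'rV[R[i]]_n) : 'rV[R[i]]_n :=
  \sum_i x 0 i *: map_mx (real_complex R) (f (delta_mx 0 i)).

Definition Cstar_rep (E : vectType R) (r : R[i] -> 'End(E)) : Prop :=
  r 1 = \1%VF /\
  (forall z w, z != 0 -> w != 0 -> r (z * w) = (r z \o r w)%VF).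

Definition hodge_piece (U : vectType rat) (r : R[i] -> 'End(tens R U))
    (p q : nat) (x : tens R[i] U) : Prop :=
  forall z, z != 0 -> complexify (r z) x = (z ^+ p * conjc z ^+ q) *: x.

(** The sum runs over [p, q >= 0] only. *)
Definition hodge_structure (U : vectType rat) (n : nat)
    (r : R[i] -> 'End(tens R U)) : Prop :=
  Cstar_rep r /\
  (forall x : tens R[i] U, exists! c : {ffun 'I_n.+1 -> tens R[i] U},
     (forall p : 'I_n.+1, hodge_piece r p (n - p) (c p)) /\ x = \sum_p c p).

Definition hodge_number (U : vectType rat) (r : R[i] -> 'End(tens R U))
    (p q h : nat) : Prop :=
  exists2 V : {vspace tens R[i] U},
    (forall x, x \in V <-> hodge_piece r p q x) & \dim V = h.

(** A Hodge structure of weight [n] (with all [p, q >= 0]) and [h^(n,0) = 1]. *)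
Definition calabi_yau_type (U : vectType rat) (n : nat)
    (r : R[i] -> 'End(tens R U)) : Prop :=
  hodge_structure n r /\ hodge_number r n 0 1.

Definition hodge_morphism (U V : vectType rat) (n : nat)
    (r : R[i] -> 'End(tens R U)) (s : R[i] -> 'End(tens R V))
    (f : 'Hom(U, V)) : Prop :=
  forall p q, (p + q = n)%N -> forall x : tens R[i] U,
    hodge_piece r p q x -> hodge_piece s p q (tens_map f x).

Definition hodge_isomorphism (U V : vectType rat) (n : nat)
    (r : R[i] -> 'End(tens R U)) (s : R[i] -> 'End(tens R V))
    (f : 'Hom(U, V)) : Prop :=
  exists g : 'Hom(V, U), [/\ cancel f g, cancel g f,
    hodge_morphism n r s f & hodge_morphism n s r g].

End Hodge.

Lemma Rcomplex_vector_axiom (R : rcfType) : vector_axiom_def 2 (Rcomplex R).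
Proof.
exists (fun x : Rcomplex R =>
  \row_(i < 2) if i == 0 then complex.Re x else complex.Im x).
  by move=> a [x1 x2] [y1 y2]; apply/rowP => i; rewrite !mxE; case: (i == 0).
exists (fun v : 'rV[R]_2 => Complex (v 0 0) (v 0 1)).
  by case=> x1 x2 /=; rewrite !mxE.
move=> v; apply/rowP => i; rewrite !mxE /=.
by case: i => [[|[|//]]] i; rewrite /=; congr (v _ _); apply: val_inj.
Qed.

HB.instance Definition _ (R : rcfType) :=
  Lmodule_hasFinDim.Build R (Rcomplex R) (@Rcomplex_vector_axiom R).

Section Representation.
Variable R : realType.
Notation C := R[i].

(** The orthogonal of [V] for [hform]; see [memv_orthv]. *)
Definition orthv (V : {vspace 'rV[C]_6}) : {vspace 'rV[C]_6} :=
  (\bigcap_(i < \dim V) lker (linfun (hform (@conjc R) (vbasis V)`_i : _ -> C^o)))%VS.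

(** [daddv_pi V W] is the projection onto [V] along [W]. *)
Definition Jmap (V : {vspace 'rV[C]_6}) : 'End('rV[C]_6) :=
  ('i%C *: daddv_pi V (orthv V) - 'i%C *: daddv_pi (orthv V) V)%VF.

Definition hmap (V : {vspace 'rV[C]_6}) (z : C) : 'End('rV[C]_6) :=
  (real_complex R (complex.Re z) *: \1 + real_complex R (complex.Im z) *: Jmap V)%VF.

Definition h3 (V : {vspace 'rV[C]_6}) (z : C) (a : ext C 6 3) : ext C 6 3 :=
  lift3 (fun u v w =>
    wedge3 (hmap V z u) (hmap V z v) (hmap V z w) : ext C^o 6 3) a.

(** Let [j] be a [rat]-linear map from [U] to the real vector space
    [\bigwedge^3 C^6]. When its extension [realize j] to [U \otimes R] is
    injective with image stable under [h3], [h3rep V j] is the representation of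
    [C^*] on [U \otimes R] obtained by restricting [h3]. *)
Definition realize (U : vectType rat) (j : U -> ext (Rcomplex R) 6 3) :
    'Hom(tens R U, ext (Rcomplex R) 6 3) :=
  linfun (tens_ext j).

Definition h3rep (V : {vspace 'rV[C]_6}) (U : vectType rat)
    (j : U -> ext (Rcomplex R) 6 3) (z : C) : 'End(tens R U) :=
  linfun (fun x => ((realize j)^-1)%VF (h3 V z (realize j x))).

Section Embedding.
Variables (K : fieldExtType rat) (iota : {rmorphism K -> C}).

Definition iotaW (w : ext K 6 3) : ext (Rcomplex R) 6 3 :=
  [ffun S => iota (w S)].

(** The identification [W \otimes R = \bigwedge^3 C^6] is induced by [iotaW];
    [s] is an [R]-linear extension of [t] to [W \otimes R = \bigwedge^3 C^6]. *)
Definition tW_extension (s : 'End(ext (Rcomplex R) 6 3)) : Prop :=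
  forall w, s (iotaW w) = iotaW (tW iota w).

Definition iotaSub (U : {vspace ext K 6 3}) (u : subvs_of U) :
    ext (Rcomplex R) 6 3 := iotaW (vsval u).

(** [U \otimes R] inside [W \otimes R]. *)
Definition realspan (U : {vspace ext K 6 3}) : {vspace ext (Rcomplex R) 6 3} :=
  limg (realize (@iotaSub U)).

Definition h3sub (V : {vspace 'rV[C]_6}) (U : {vspace ext K 6 3}) :
    C -> 'End(tens R (subvs_of U)) := h3rep V (@iotaSub U).

(** [U \otimes C -> \bigwedge^3 C^6], [u \otimes z |-> z u]; see [natmapE]. *)
Definition natmap (U : {vspace ext K 6 3}) :
    'Hom(tens C (subvs_of U), ext C^o 6 3) :=
  linfun (tens_ext (fun u => iotaSub u : ext C^o 6 3)).

End Embedding.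

End Representation.

Lemma iotaWD (R : realType) (K : fieldExtType rat) (iota : {rmorphism K -> R[i]}) :
  {morph iotaW iota : u v / u + v}.
Proof. by move=> u v; apply/ffunP => S; rewrite !ffunE rmorphD. Qed.

Lemma iotaZ (R : realType) (K : fieldExtType rat) (iota : {rmorphism K -> R[i]}) a (x : K) :
  iota (a *: x) = ratr a * iota x.
Proof.
rewrite -mulr_algl rmorphM; congr (_ * _).
exact: (fmorph_eq_rat (iota \o in_alg K)).
Qed.

Lemma natmapE (R : realType) (K : fieldExtType rat) (iota : {rmorphism K -> R[i]})
    (U : {vspace ext K 6 3}) (u : subvs_of U) (z : R[i]) :
  natmap iota U (tensor u z) = z *: (iotaSub iota u : ext R[i]^o 6 3).
Proof.
rewrite /natmap linfunE; last exact: tens_ext_linear.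
apply: tens_extE => [v w|a v].
  by rewrite /iotaSub linearD iotaWD.
by apply/ffunP => S; rewrite /iotaSub linearZ !ffunE iotaZ.
Qed.

Lemma hform_linear (F : fieldType) (cj : F -> F) v :
  linear (hform cj v : _ -> F^o).
Proof.
move=> a u w; rewrite /hform scaler_sumr -big_split /=; apply: eq_bigr => i _.
by rewrite !mxE /GRing.scale /=; ring.
Qed.

Lemma memv_orthv (R : realType) (V : {vspace 'rV[R[i]]_6}) w :
  w \in orthv V <-> forall v, v \in V -> hform (@conjc R) v w = 0.
Proof.
have E v : (w \in lker (linfun (hform (@conjc R) v : _ -> R[i]^o)))
    = (hform (@conjc R) v w == 0).
  by rewrite memv_ker linfunE //; apply: hform_linear.
rewrite /orthv memvE; split=> [/subv_bigcapP wV v vV|wV].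
  rewrite (coord_vbasis vV).
  rewrite /hform; under eq_bigr => j _.
    rewrite summxE rmorph_sum mulr_sumr mulr_suml.
    under eq_bigr => i _ do rewrite mxE rmorphM.
    over.
  rewrite exchange_big big1 //= => i _.
  have := wV i isT.
  rewrite -memvE E => /eqP h0.
  transitivity (conjc (coord (vbasis V) i v) * hform (@conjc R) (vbasis V)`_i w).
    by rewrite mulr_sumr; apply: eq_bigr => j _; ring.
  by rewrite h0 mulr0.
apply/subv_bigcapP => i _; rewrite -memvE E wV //.
by apply: vbasis_mem; rewrite mem_nth // size_tuple.
Qed.

Section Subspaces.
Variables (F : fieldType) (n : nat).

(** The span of all [wedge a b] with [a \in A] and [b \in B]; see
    [mem_wedgev]. *)
Definition wedgev k l (A : {vspace ext F^o n k}) (B : {vspace ext F^o n l}) :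
    {vspace ext F^o n (k + l)} :=
  <<[seq (wedge (a : ext F n k) (b : ext F n l) : ext F^o n (k + l))
     | a <- vbasis A, b <- vbasis B]>>%VS.

Lemma mem_wedgev k l (A : {vspace ext F^o n k})
    (B : {vspace ext F^o n l}) a b :
  a \in A -> b \in B ->
  (wedge (a : ext F n k) (b : ext F n l) : ext F^o n (k + l)) \in wedgev A B.
Proof.
move=> aA bB.
have -> : (wedge (a : ext F n k) (b : ext F n l) : ext F^o n (k + l)) =
    \sum_i \sum_j (coord (vbasis A) i a * coord (vbasis B) j b) *:
      (wedge ((vbasis A)`_i : ext F n k) ((vbasis B)`_j : ext F n l)
         : ext F^o n (k + l)).
  have Ea S : a S = \sum_i coord (vbasis A) i a * (vbasis A)`_i S.
    by rewrite {1}(coord_vbasis aA) sum_ffunE; apply: eq_bigr => i _; rewrite !ffunE.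
  have Eb S : b S = \sum_i coord (vbasis B) i b * (vbasis B)`_i S.
    by rewrite {1}(coord_vbasis bB) sum_ffunE; apply: eq_bigr => i _; rewrite !ffunE.
  apply/ffunP => U; rewrite sum_ffunE ffunE.
  under [RHS]eq_bigr => i _.
    rewrite sum_ffunE; under eq_bigr => j _.
      rewrite !ffunE scaler_sumr; under eq_bigr => S _ do rewrite scaler_sumr.
      over.
    rewrite exchange_big /=.
    under eq_bigr => S _ do rewrite exchange_big /=.
    over.
  rewrite [RHS]exchange_big; apply: eq_bigr => S _.
  rewrite [RHS]exchange_big; apply: eq_bigr => T _.
  rewrite Ea Eb big_distrlr /= mulr_sumr; apply: eq_bigr => i _.
  rewrite mulr_sumr; apply: eq_bigr => j _.
  by rewrite /GRing.scale /=; ring.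
apply: memv_suml => i _; apply: memv_suml => j _; apply: rpredZ.
apply/memv_span/allpairsP; exists ((vbasis A)`_i, (vbasis B)`_j).
by split=> //=; rewrite mem_nth // size_tuple.
Qed.

(** [\bigwedge^k A] inside [\bigwedge^k F^n]. *)
Fixpoint extpow (A : {vspace 'rV[F]_n}) k : {vspace ext F^o n k} :=
  if k is k'.+1 then
    wedgev (k := 1) <<[seq (ext1 v : ext F^o n 1) | v <- vbasis A]>>%VS
      (extpow A k')
  else fullv.

(** [\bigwedge^p A \otimes \bigwedge^q B], viewed in [\bigwedge^m F^n] by
    [wedge], where [m = p + q]. *)
Definition pqspace (A B : {vspace 'rV[F]_n}) (p q m : nat) (e : (p + q = m)%N) :
    {vspace ext F^o n m} :=
  ecast d {vspace ext F^o n d} e (wedgev (extpow A p) (extpow B q)).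

End Subspaces.

(* Main.v *)
Require Import Defs.
From HB Require Import structures.
From mathcomp Require Import all_boot all_order all_algebra all_field.
From mathcomp Require Import complex reals ring zify.

Set Implicit Arguments.
Unset Strict Implicit.
Unset Printing Implicit Defensive.

Import Order.TTheory GRing.Theory Num.Theory.
Local Open Scope ring_scope.

(** [\bigwedge C^6] is an associative algebra in which vectors square to zero, so
    [gamma (a /\ b)] vanishes on decomposable [a], [b] sharing a vector. Take a
    basis of [C^6] whose first three vectors span [V_+] and whose last three span
    [V_-]. On the induced basis [e_S] of [\bigwedge^3 C^6] the operator [h_3(z)] is
    diagonal, with eigenvalue [z^p zbar^q] where [p] counts the elements of [S]
    below 3; this gives the eigenspaces and their dimensions 1, 9, 9, 1.
    Both [gamma (a /\ b)] and [H~(a, b)] are multiplied by [(z zbar)^3] when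
    [h_3(z)] is applied to both arguments (the former because complementary [S]
    have eigenvalues with this product), and [gamma (t a /\ b) = H~(a, b)], so
    [t] commutes with [h_3(z)].
    On coordinates [t] maps [a] to [S |-> +- conj (a (~: S))], hence [t^2 = 1].
    As [theta = 2 omega + 1] satisfies [conj theta = - theta], multiplication by
    it exchanges [W_+] and [W_-]; so they have equal dimension, and [W_+] spans
    [\bigwedge^3 C^6] over [C], bijectively by dimension count. *)

(** * The exterior algebra *)

(** Hodge pieces live on the abstract space [tens C], whereas [h3] acts on trivectors. The bijection
    [natmap] intertwines the complexified representation with [h3], so every Hodge statement becomes
    one about eigenvectors of [h3] in the third exterior power of C^6, the same for W_+ and W_-.

    The commutation of [t] with [h3] cannot be read off from the coordinate formula for [t]: that
    formula is tied to the standard basis, while [h3] is diagonal only in a basis adapted to V_+,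
    which need not be orthonormal. Hence the argument through the two pairings. The bilinear one
    scales by det h(z) = z^3 zbar^3, the sesquilinear one by the cube of the factor z zbar by which
    h(z) scales [hform]; the two agree because V_+ and V_- have the same dimension. *)

Section ExteriorAlgebra.
Variables (F : comNzRingType) (n : nat).

(** Indexing by all subsets instead of [ksub n k] keeps degrees out of the types,
    so that associativity [emulA] can be stated without casts. *)
Definition ealg := {ffun {set 'I_n} -> F}.

(** Without fixed degrees the cardinality of a union no longer forces disjointness, so the sign
    itself must vanish on intersecting sets. *)
Definition dsign (S T : {set 'I_n}) : F :=
  if [disjoint S & T] then shuffle_sign F S T else 0.

Definition emul (x y : ealg) : ealg :=
  [ffun U => \sum_S \sum_(T | S :|: T == U) dsign S T * (x S * y T)].

Lemma big_setUd (M : nmodType) (A B : {set 'I_n}) (G : 'I_n -> M) : [disjoint A & B] ->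
  \sum_(i in A :|: B) G i = \sum_(i in A) G i + \sum_(i in B) G i.
Proof. by move=> dAB; rewrite -bigU //; apply: eq_bigl => i; rewrite !inE. Qed.

Lemma shuffle_signUl (A B C : {set 'I_n}) : [disjoint A & B] ->
  shuffle_sign F (A :|: B) C = shuffle_sign F A C * shuffle_sign F B C.
Proof. by move=> dAB; rewrite !shuffle_signE big_setUd // exprD. Qed.

Lemma shuffle_signUr (A B C : {set 'I_n}) : [disjoint B & C] ->
  shuffle_sign F A (B :|: C) = shuffle_sign F A B * shuffle_sign F A C.
Proof.
move=> dBC; rewrite !shuffle_signE -exprD -big_split /=; congr (_ ^+ _).
by apply: eq_bigr => i _; rewrite big_setUd.
Qed.

(** Associativity on basis elements: both sides vanish unless the three sets are pairwise disjoint,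
    and then both count the inversions of the pairs (A, B), (A, C) and (B, C). *)
Lemma dsignA (A B C : {set 'I_n}) :
  dsign A B * dsign (A :|: B) C = dsign A (B :|: C) * dsign B C.
Proof.
rewrite /dsign -!setI_eq0 setIUl setIUr !setU_eq0 !setI_eq0.
have [dAB|] := boolP [disjoint A & B]; last by rewrite !mul0r.
have [dBC|] := boolP [disjoint B & C]; last by rewrite andbF !mulr0.
rewrite andbT; case: ifP => _; rewrite ?mulr0 ?mul0r //.
by rewrite shuffle_signUl // shuffle_signUr // mulrA.
Qed.

Lemma sum_emul (h : {set 'I_n} -> F) (x y : ealg) :
  \sum_T h T * emul x y T = \sum_A \sum_B h (A :|: B) * (dsign A B * (x A * y B)).
Proof.
under eq_bigr => T _ do rewrite ffunE mulr_sumr.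
rewrite exchange_big; apply: eq_bigr => A _ /=.
under eq_bigr => T _ do rewrite mulr_sumr.
rewrite (exchange_big_dep xpredT) //=; apply: eq_bigr => B _.
by rewrite (big_pred1 (A :|: B)) // => T; rewrite eq_sym.
Qed.

Lemma emulA (x y z : ealg) : emul (emul x y) z = emul x (emul y z).
Proof.
apply/ffunP => U.
(* Turning the condition on the union into a 0-1 coefficient makes the three sums independent, so
   that [sum_emul] can expand the inner product. *)
transitivity (\sum_A \sum_B \sum_C (A :|: B :|: C == U)%:R *
    (dsign A B * dsign (A :|: B) C * (x A * y B * z C))).
  rewrite ffunE (exchange_big_dep xpredT) //=.
  under eq_bigr => C _.
    rewrite big_mkcond /=.
    under eq_bigr => T _.
      rewrite (_ : (if _ then _ else _) = ((T :|: C == U)%:R * dsign T C * z C) * emul x y T); last first.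
        by case: eqP => _; rewrite ?mul1r ?mul0r ?mul0rn //; ring.
      over.
    rewrite sum_emul.
    over.
  rewrite exchange_big; apply: eq_bigr => A _.
  rewrite exchange_big; apply: eq_bigr => B _; apply: eq_bigr => C _.
  by ring.
rewrite ffunE; apply: eq_bigr => A _.
rewrite [RHS]big_mkcond /=.
under [RHS]eq_bigr => T _.
  rewrite (_ : (if _ then _ else _) = ((A :|: T == U)%:R * dsign A T * x A) * emul y z T); last first.
    by case: eqP => _; rewrite ?mul1r ?mul0r ?mul0rn //; ring.
  over.
rewrite sum_emul; apply: eq_bigr => B _; apply: eq_bigr => C _.
by rewrite dsignA setUA; ring.
Qed.

Definition emb k (a : ext F n k) : ealg :=
  [ffun S => if insub S is Some s then a s else 0].

Lemma emb_val k (a : ext F n k) s : emb a (val s) = a s.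
Proof. by rewrite ffunE valK. Qed.

Lemma emb_out k (a : ext F n k) (S : {set 'I_n}) : #|S| != k -> emb a S = 0.
Proof. by move=> nS; rewrite ffunE insubN. Qed.

Lemma emb_inj k : injective (@emb k).
Proof.
by move=> a b E; apply/ffunP => s; rewrite -!emb_val E.
Qed.

Lemma sum_emb k (a : ext F n k) (h : {set 'I_n} -> F) :
  \sum_S h S * emb a S = \sum_s h (val s) * a s.
Proof.
rewrite (bigID (fun S : {set 'I_n} => #|S| == k)) /= addrC big1 ?add0r => [|S nS].
  rewrite (reindex_omap (val : ksub n k -> _) insub) => [|S cS]; last by rewrite insubT.
  by apply: eq_big => [s|s _]; rewrite ?emb_val // valK eqxx (valP s).
by rewrite emb_out ?mulr0.
Qed.

(** The cardinality of S :|: T is the sum of those of S and T exactly for disjoint sets, so the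
    condition implicit in the degrees of [wedge] is the vanishing built into [dsign]. *)
Lemma emb_wedge k l (a : ext F n k) (b : ext F n l) :
  emb (wedge a b) = emul (emb a) (emb b).
Proof.
apply/ffunP => U.
have E : emul (emb a) (emb b) U = \sum_(S : ksub n k) \sum_(T : ksub n l)
    (val S :|: val T == U)%:R * dsign (val S) (val T) * (a S * b T).
  rewrite ffunE.
  under eq_bigr => S _.
    rewrite big_mkcond /=.
    under eq_bigr => T _.
      rewrite (_ : (if _ then _ else _) = ((S :|: T == U)%:R * dsign S T * emb a S) * emb b T); last first.
        by case: eqP => _; rewrite ?mul1r ?mul0r ?mul0rn //; ring.
      over.
    rewrite sum_emb.
    over.
  rewrite exchange_big [RHS]exchange_big; apply: eq_bigr => T _ /=.
  under eq_bigr => S _ do rewrite mulrAC.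
  by rewrite sum_emb; apply: eq_bigr => S _; ring.
rewrite {}E; have [cU|cU] := boolP (#|U| == (k + l)%N); last first.
  rewrite emb_out // big1 // => S _; rewrite big1 // => T _.
  case: eqP => [E|]; last by rewrite !mul0r.
  rewrite /dsign; case: ifP => d; last by rewrite mulr0 mul0r.
  by move: d; rewrite -(leq_card_setU _ _).2 E (eqP (valP S)) (eqP (valP T)) (negPf cU).
rewrite -[U in LHS](SubK (ksub n (k + l)) cU) emb_val ffunE SubK.
apply: eq_bigr => S _; rewrite big_mkcond; apply: eq_bigr => T _ /=.
case: eqP => E; last by rewrite !mul0r.
rewrite mul1r /dsign -(leq_card_setU _ _).2 E (eqP cU).
by rewrite (eqP (valP S)) (eqP (valP T)) eqxx.
Qed.

Definition eone : ext F n 0 := [ffun=> 1].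

Lemma emb_eone S : emb eone S = (S == set0)%:R.
Proof.
have [->|nS] := eqVneq S set0; last by rewrite emb_out // cards_eq0.
have c0 : #|set0 : {set 'I_n}| == 0%N by rewrite cards0.
by rewrite -[set0](SubK (ksub n 0) c0) emb_val ffunE.
Qed.

Lemma shuffle_sign0l (S : {set 'I_n}) : shuffle_sign F set0 S = 1.
Proof. by rewrite shuffle_signE big_set0. Qed.

Lemma shuffle_sign0r (S : {set 'I_n}) : shuffle_sign F S set0 = 1.
Proof. by rewrite shuffle_signE big1 // => i _; rewrite big_set0. Qed.

Lemma emul1l x : emul (emb eone) x = x.
Proof.
apply/ffunP => U; rewrite ffunE (bigD1 set0) //= [X in _ + X]big1 ?addr0 => [|S nS].
  rewrite (big_pred1 U) => [|T]; last by rewrite set0U.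
  by rewrite emb_eone eqxx mul1r /dsign -setI_eq0 set0I eqxx shuffle_sign0l mul1r.
by rewrite big1 // => T _; rewrite emb_eone (negPf nS) mul0r mulr0.
Qed.

Lemma emul1r x : emul x (emb eone) = x.
Proof.
apply/ffunP => U; rewrite ffunE (exchange_big_dep xpredT) //= (bigD1 set0) //=.
rewrite [X in _ + X]big1 ?addr0 => [|S nS].
  rewrite (big_pred1 U) => [|T]; last by rewrite setU0.
  by rewrite emb_eone eqxx mulr1 /dsign -setI_eq0 setI0 eqxx shuffle_sign0r mul1r.
by rewrite big1 // => T _; rewrite emb_eone (negPf nS) !mulr0.
Qed.

Lemma emul0l x : emul 0 x = 0.
Proof.
by apply/ffunP => U; rewrite !ffunE big1 // => S _; rewrite big1 // => T _; rewrite ffunE mul0r mulr0.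
Qed.

Lemma emul0r x : emul x 0 = 0.
Proof.
by apply/ffunP => U; rewrite !ffunE big1 // => S _; rewrite big1 // => T _; rewrite ffunE !mulr0.
Qed.

Lemma emb0 k : emb (0 : ext F n k) = 0.
Proof. by apply/ffunP => S; rewrite !ffunE; case: insubP => // s; rewrite ffunE. Qed.

Lemma wedge3r (u v w : 'rV[F]_n) :
  wedge3 u v w = wedge (ext1 u) (wedge (ext1 v) (ext1 w)).
Proof.
apply: (@emb_inj 3).
apply: (etrans (emb_wedge (wedge (ext1 u) (ext1 v)) (ext1 w))).
rewrite emb_wedge emulA -(emb_wedge (ext1 v)).
by rewrite -(emb_wedge (ext1 u) (wedge (ext1 v) (ext1 w))).
Qed.

Lemma wedge0l k l (b : ext F n l) : wedge (0 : ext F n k) b = 0.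
Proof. by apply: emb_inj; rewrite emb_wedge !emb0 emul0l. Qed.

Lemma wedge0r k l (a : ext F n k) : wedge a (0 : ext F n l) = 0.
Proof. by apply: emb_inj; rewrite emb_wedge !emb0 emul0r. Qed.

Lemma wedgeDl k l c (a a' : ext F n k) (b : ext F n l) S :
  wedge (c *: (a : ext F^o n k) + a' : ext F^o n k) b S = c * wedge a b S + wedge a' b S.
Proof.
rewrite !ffunE mulr_sumr -big_split; apply: eq_bigr => T _ /=.
rewrite mulr_sumr -big_split; apply: eq_bigr => U _ /=.
by rewrite !ffunE /GRing.scale /=; ring.
Qed.

Lemma wedgeDr k l c (a : ext F n k) (b b' : ext F n l) S :
  wedge a (c *: (b : ext F^o n l) + b' : ext F^o n l) S = c * wedge a b S + wedge a b' S.
Proof.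
rewrite !ffunE mulr_sumr -big_split; apply: eq_bigr => T _ /=.
rewrite mulr_sumr -big_split; apply: eq_bigr => U _ /=.
by rewrite !ffunE /GRing.scale /=; ring.
Qed.

Lemma ext1D c (u v : 'rV[F]_n) :
  ext1 (c *: u + v) = c *: (ext1 u : ext F^o n 1) + ext1 v :> ext F^o n 1.
Proof.
apply/ffunP => S; rewrite !ffunE scaler_sumr -big_split; apply: eq_bigr => i _.
by rewrite !mxE.
Qed.

Lemma wedge3D1 c (u u' v w : 'rV[F]_n) :
  wedge3 (c *: u + u') v w = c *: (wedge3 u v w : ext F^o n 3) + wedge3 u' v w :> ext F^o n 3.
Proof.
apply/ffunP => S; rewrite !wedge3r ext1D.
by rewrite [LHS](wedgeDl c (ext1 u) (ext1 u') (wedge (ext1 v) (ext1 w))) !ffunE.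
Qed.

Lemma wedge3D3 c (u v w w' : 'rV[F]_n) :
  wedge3 u v (c *: w + w') = c *: (wedge3 u v w : ext F^o n 3) + wedge3 u v w' :> ext F^o n 3.
Proof.
apply/ffunP => S; rewrite /wedge3 ext1D.
by rewrite [LHS](wedgeDr c (wedge (ext1 u) (ext1 v)) (ext1 w) (ext1 w')) !ffunE.
Qed.

Lemma wedge3D2 c (u v v' w : 'rV[F]_n) :
  wedge3 u (c *: v + v') w = c *: (wedge3 u v w : ext F^o n 3) + wedge3 u v' w :> ext F^o n 3.
Proof.
apply/ffunP => S; rewrite /wedge3 ext1D.
have -> : wedge (ext1 u) (c *: (ext1 v : ext F^o n 1) + (ext1 v' : ext F^o n 1) : ext F^o n 1)
  = c *: (wedge (ext1 u) (ext1 v) : ext F^o n 2) + (wedge (ext1 u) (ext1 v') : ext F^o n 2) :> ext F^o n 2.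
  by apply/ffunP => T; rewrite [LHS](wedgeDr c (ext1 u) (ext1 v) (ext1 v')) !ffunE.
by rewrite [LHS](wedgeDl c (wedge (ext1 u) (ext1 v)) (wedge (ext1 u) (ext1 v')) (ext1 w)) !ffunE.
Qed.

Lemma wedge_ext1C (v w : 'rV[F]_n) (S : ksub n 2) :
  wedge (ext1 v) (ext1 w) S = - wedge (ext1 w) (ext1 v) S.
Proof.
rewrite !ffunE [LHS](exchange_big_dep xpredT) //= -sumrN.
rewrite big_ksub1 [RHS]big_ksub1; apply: eq_bigr => i _.
rewrite big_ksub1 [in RHS]big_ksub1 -sumrN /=; apply: eq_big => [j|j E]; first by rewrite setUC.
rewrite !ext1_sing [w 0 i * _]mulrC -mulNr; congr (_ * _).
rewrite !shuffle_signE !big_set1.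
have [ij|ji|/val_inj ij] := ltngtP i j; rewrite ?expr0 ?expr1 ?opprK //.
by have := valP S; rewrite /= -(eqP E) ij setUid cards1.
Qed.

End ExteriorAlgebra.

Lemma oppr_eq_id (F : numFieldType) (x : F) : x = - x -> x = 0.
Proof.
move/eqP; rewrite -addr_eq0 -mulr2n -mulr_natr mulf_eq0 pnatr_eq0 orbF.
by move/eqP.
Qed.

Section Alternating.
Variables (F : numFieldType) (n : nat).

(** Anticommutativity only gives that twice the square is 0; characteristic 0 is used to divide by
    2. *)
Lemma wedge_ext1_id (v : 'rV[F]_n) : wedge (ext1 v) (ext1 v) = 0.
Proof. by apply/ffunP => S; rewrite [RHS]ffunE; apply: oppr_eq_id; apply: wedge_ext1C. Qed.

Lemma wedge3_alt12 (u w : 'rV[F]_n) : wedge3 u u w = 0.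
Proof. by rewrite /wedge3 wedge_ext1_id; apply: (@wedge0l _ _ 2 1). Qed.

Lemma wedge3_alt23 (u v : 'rV[F]_n) : wedge3 u v v = 0.
Proof. by rewrite wedge3r wedge_ext1_id; apply: (@wedge0r _ _ 1 2). Qed.

Lemma wedge3N12 (u v w : 'rV[F]_n) :
  wedge3 v u w = - (wedge3 u v w : ext F^o n 3) :> ext F^o n 3.
Proof.
apply: (phiN12 (cj := idfun)) => *;
  rewrite ?wedge3D1 ?wedge3D2 ?wedge3D3 ?wedge3_alt12 ?wedge3_alt23 //.
Qed.

Lemma wedge3N23 (u v w : 'rV[F]_n) :
  wedge3 u w v = - (wedge3 u v w : ext F^o n 3) :> ext F^o n 3.
Proof.
apply: (phiN23 (cj := idfun)) => *;
  rewrite ?wedge3D1 ?wedge3D2 ?wedge3D3 ?wedge3_alt12 ?wedge3_alt23 //.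
Qed.

End Alternating.
(** * Functoriality of the third exterior power *)

Lemma ksub3P n (S : ksub n 3) : exists a b c : 'I_n,
  [/\ (a < b)%N, (b < c)%N & val S = [set a; b; c]].
Proof.
have sz : size (enum (val S)) = 3 by rewrite -cardE (eqP (valP S)).
have srt : sorted (relpre val ltn) (enum (val S)).
  rewrite {1}/enum_mem; apply: sorted_filter; first by move=> x y z /=; apply: ltn_trans.
  by rewrite -enumT -(sorted_map (e' := ltn) (f := val)) val_enum_ord iota_ltn_sorted.
have E i : (i \in val S) = (i \in enum (val S)) by rewrite mem_enum.
move: sz srt E; case: (enum _) => [|a [|b [|c []]]] //= _ /and3P[ab bc _] E.
exists a, b, c; split => //; apply/setP => i.
by rewrite E !inE orbA.
Qed.

Section Functor.
Variables (F : numFieldType) (n : nat).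

Definition evec (S : ksub n 3) : ext F n 3 := [ffun T => (T == S)%:R].

Lemma ext_evec (a : ext F n 3) : a = \sum_S a S *: (evec S : ext F^o n 3) :> ext F^o n 3.
Proof.
apply/ffunP => T; rewrite sum_ffunE (bigD1 T) //= big1 ?addr0 => [|S nS].
  by rewrite !ffunE eqxx /GRing.scale /= mulr1.
by rewrite !ffunE eq_sym (negPf nS) /GRing.scale /= mulr0.
Qed.

Definition coordspace (P : pred (ksub n 3)) : {vspace ext F^o n 3} :=
  <<[seq (evec U : ext F^o n 3) | U <- enum P]>>%VS.

Lemma mem_coordspace P (a : ext F^o n 3) :
  a \in coordspace P <-> forall S, ~~ P S -> a S = 0.
Proof.
pose Q (a : ext F^o n 3) : ext F^o n 3 := [ffun S => if P S then 0 else a S].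
have QL : linear Q.
  by move=> c x y; apply/ffunP => S; rewrite !ffunE; case: ifP; rewrite ?scaler0 ?addr0.
split=> [aP S nS|a0].
  have : (coordspace P <= lker (linfun Q))%VS.
    apply/span_subvP => _ /mapP[T + ->]; rewrite mem_enum memv_ker linfunE // => PT.
    apply/eqP/ffunP => U; rewrite !ffunE; case: ifP => // nU.
    by case: eqP => // UT; rewrite UT -[P T]/(T \in P) PT in nU.
  move/subvP/(_ _ aP); rewrite memv_ker linfunE // => /eqP/ffunP/(_ S).
  by rewrite !ffunE (negPf nS).
rewrite (ext_evec (a : ext F n 3)); apply: memv_suml => S _.
have [PS|/a0 ->] := boolP (P S); last by rewrite scale0r mem0v.
by apply/memvZ/memv_span/map_f; rewrite mem_enum.
Qed.

(** Counting generators bounds the dimensions for [P] and for its complement from above. The two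
    spaces together span everything, so both bounds are attained, without a separate proof of
    freeness. *)
Lemma dim_coordspace P : \dim (coordspace P) = #|P|.
Proof.
have le Q : (\dim (coordspace Q) <= #|Q|)%N.
  by apply: leq_trans (dim_span _) _; rewrite size_map -cardE.
apply/eqP; rewrite eqn_leq le -(leq_add2r #|predC P|) cardC.
have -> : #|{: ksub n 3}| = \dim {: ext F^o n 3} by rewrite dimvf /dim /= muln1.
have -> : {: ext F^o n 3}%VS = (coordspace P + coordspace (predC P))%VS.
  apply/esym/eqP; rewrite eqEsubv subvf /=; apply/subvP => a _.
  pose part (Q : pred (ksub n 3)) : ext F^o n 3 := [ffun S => if Q S then (a : ext F n 3) S else 0].
  have -> : a = part P + part (predC P).
    by apply/ffunP => S; rewrite !ffunE /=; case: (P S); rewrite ?addr0 ?add0r.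
  by apply: memv_add; apply/mem_coordspace => S nS; rewrite ffunE (negPf nS).
exact: leq_trans (dimv_add_leqif _ _) (leq_add (leqnn _) (le _)).
Qed.

Lemma wedge3_bvec (S : ksub n 3) :
  wedge3 (bvec F S ord0) (bvec F S (lift ord0 ord0)) (bvec F S ord_max) = evec S.
Proof.
have [a [b [c [ab bc SE]]]] := ksub3P S.
have [-> -> ->] := bvec_ksub3 F ab bc SE.
have ac := ltn_trans ab bc.
apply/ffunP => T; rewrite wedge3E ffunE.
rewrite (bigD1 a) //= [X in _ + X]big1 ?addr0 => [|i ni]; last first.
  by rewrite big1 // => j _; rewrite big1 // => k _; rewrite !mxE (negPf ni) andbF !mul0r mulr0.
rewrite (bigD1 b) //= [X in _ + X]big1 ?addr0 => [|i ni]; last first.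
  by rewrite big1 // => k _; rewrite !mxE (negPf ni) andbF mulr0 mul0r mulr0.
rewrite (bigD1 c) //= [X in _ + X]big1 ?addr0 => [|i ni]; last first.
  by rewrite !mxE (negPf ni) andbF !mulr0.
rewrite !mxE !eqxx /= !mulr1 -SE /sgn3.
rewrite [_ != _](_ : _ = true); last by rewrite neq_ltn ab.
have -> : (b < a)%N = false by rewrite ltnNge ltnW.
have -> : (c < a)%N = false by rewrite ltnNge ltnW.
have -> : (c < b)%N = false by rewrite ltnNge ltnW.
by rewrite /= !mulr1 eq_sym val_eqE; case: eqP.
Qed.

(** For linear [g] this is the third exterior power of [g]; [h3] is convertible to the case of
    [hmap]. *)
Definition ext3map (g : 'rV[F]_n -> 'rV[F]_n) (a : ext F n 3) : ext F n 3 :=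
  lift3 (fun u v w => wedge3 (g u) (g v) (g w) : ext F^o n 3) a.

Lemma ext3map_linear g : linear (ext3map g : ext F^o n 3 -> ext F^o n 3).
Proof.
move=> c a b; rewrite /ext3map /lift3 scaler_sumr -big_split; apply: eq_bigr => S _.
by rewrite !ffunE scalerDl scalerA.
Qed.

Lemma ext3map_linearZ g c (a : ext F n 3) :
  ext3map g (c *: (a : ext F^o n 3)) = c *: (ext3map g a : ext F^o n 3) :> ext F^o n 3.
Proof. by rewrite -!(linfunE (ext3map_linear g)) linearZ. Qed.

Lemma ext3map_wedge3 (g : 'rV[F]_n -> 'rV[F]_n) : linear g ->
  forall u v w, ext3map g (wedge3 u v w) = wedge3 (g u) (g v) (g w).
Proof.
move=> gL u v w; apply: (lift3_wedge3 (M := ext F^o n 3)) => *.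
- by move=> c x y; rewrite gL wedge3D1.
- by move=> c x y; rewrite gL wedge3D2.
- by move=> c x y; rewrite gL wedge3D3.
- exact: wedge3_alt12.
- exact: wedge3_alt23.
Qed.

Lemma ext3mapE g (a : ext F n 3) :
  ext3map g a = \sum_S a S *: (ext3map g (evec S) : ext F^o n 3) :> ext F^o n 3.
Proof.
apply: eq_bigr => S _; congr (_ *: _).
rewrite /ext3map /lift3 (bigD1 S) //= big1 ?addr0 => [|T nT].
  by rewrite !ffunE eqxx scale1r.
by rewrite !ffunE (negPf nT) scale0r.
Qed.

Lemma ext3map_ext g (k : ext F n 3 -> ext F n 3) : linear (k : ext F^o n 3 -> ext F^o n 3) ->
  (forall S, ext3map g (evec S) = k (evec S)) -> ext3map g =1 k.
Proof.
move=> kL E a; rewrite ext3mapE {2}(ext_evec a).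
pose k' : {linear ext F^o n 3 -> ext F^o n 3} :=
  HB.pack (k : ext F^o n 3 -> ext F^o n 3) (GRing.isLinear.Build F (ext F^o n 3) (ext F^o n 3) *:%R _ kL).
rewrite -[k _]/(k' _) linear_sum; apply: eq_bigr => S _.
by rewrite linearZ E.
Qed.

Lemma ext3map_evec (g : 'rV[F]_n -> 'rV[F]_n) S :
  ext3map g (evec S) =
    wedge3 (g (bvec F S ord0)) (g (bvec F S (lift ord0 ord0))) (g (bvec F S ord_max)).
Proof.
rewrite /ext3map /lift3 (bigD1 S) //= big1 ?addr0 => [|T nT].
  by rewrite ffunE eqxx scale1r.
by rewrite ffunE (negPf nT) scale0r.
Qed.

Lemma ext3map_id (a : ext F n 3) : ext3map id a = a.
Proof. by apply: (ext3map_ext (k := id)) => // S; rewrite ext3map_evec wedge3_bvec. Qed.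

Lemma ext3map_comp (g h : 'rV[F]_n -> 'rV[F]_n) (a : ext F n 3) : linear g ->
  ext3map g (ext3map h a) = ext3map (g \o h) a.
Proof.
move=> gL; symmetry; move: a; apply: (ext3map_ext (k := fun a => ext3map g (ext3map h a))).
  by move=> c a b; rewrite -(ext3map_linear g) -ext3map_linear.
by move=> S; rewrite !ext3map_evec ext3map_wedge3.
Qed.

Lemma eq_ext3map (g h : 'rV[F]_n -> 'rV[F]_n) : g =1 h -> ext3map g =1 ext3map h.
Proof. by move=> E a; apply: eq_bigr => S _; rewrite !E. Qed.

(** Cyclic rotations of three factors are even, so any factor moves to the end, or to the front,
    without a sign. *)
Lemma wedge3_last (u v w x : 'rV[F]_n) : x \in [:: u; v; w] ->
  exists y z, wedge3 u v w = wedge3 y z x.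
Proof.
rewrite !inE => /or3P[]/eqP->; [exists v, w|exists w, u|by exists u, v].
  by rewrite [RHS]wedge3N23 [X in - X]wedge3N12 opprK.
by rewrite [RHS]wedge3N12 [X in - X]wedge3N23 opprK.
Qed.

Lemma wedge3_first (u v w x : 'rV[F]_n) : x \in [:: u; v; w] ->
  exists y z, wedge3 u v w = wedge3 x y z.
Proof.
rewrite !inE => /or3P[]/eqP->; [by exists v, w|exists w, u|exists u, v].
  by rewrite [RHS]wedge3N23 [X in - X]wedge3N12 opprK.
by rewrite [RHS]wedge3N12 [X in - X]wedge3N23 opprK.
Qed.

(** With the shared vector last on the left and first on the right, associativity brings its square
    into the middle of the product. *)
Lemma wedge_wedge3_shared (u v w u' v' w' x : 'rV[F]_n) :
  x \in [:: u; v; w] -> x \in [:: u'; v'; w'] ->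
  wedge (wedge3 u v w) (wedge3 u' v' w') = 0.
Proof.
move=> /wedge3_last[y [z ->]] /wedge3_first[y' [z' ->]].
apply: emb_inj; rewrite emb_wedge (wedge3r x).
rewrite (emb_wedge (wedge (ext1 y) (ext1 z)) (ext1 x)).
rewrite (emb_wedge (ext1 x) (wedge (ext1 y') (ext1 z'))).
by rewrite emulA -(emulA (emb (ext1 x))) -emb_wedge wedge_ext1_id emb0 emul0l emul0r emb0.
Qed.

End Functor.
(** * Spans of wedge products *)

Section WedgeSpaces.
Variables (F : numFieldType) (n : nat).

Lemma linear_span_sub (U V : vectType F) (phi : U -> V) (X : seq U) (E : {vspace V}) :
  linear phi -> {in X, forall x, phi x \in E} -> {in <<X>>%VS, forall x, phi x \in E}.
Proof.
move=> pL XE x xX; have : (<<X>> <= linfun phi @^-1: E)%VS.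
  by apply/span_subvP => y yX; rewrite -memv_preim (linfunE pL) XE.
by move/subvP/(_ _ xX); rewrite -memv_preim (linfunE pL).
Qed.

Lemma wedgev_le k l (A : {vspace ext F^o n k}) (B : {vspace ext F^o n l})
    (E : {vspace ext F^o n (k + l)}) :
  (forall a b, a \in A -> b \in B ->
    (wedge (a : ext F n k) (b : ext F n l) : ext F^o n (k + l)) \in E) ->
  (wedgev A B <= E)%VS.
Proof.
by move=> AB; apply/span_subvP => _ /allpairsP[[a b] /= [aA bB ->]]; apply: AB; apply: vbasis_mem.
Qed.

Definition ext1space (A : {vspace 'rV[F]_n}) : {vspace ext F^o n 1} :=
  <<[seq (ext1 v : ext F^o n 1) | v <- vbasis A]>>%VS.

Lemma ext1_linear : linear (@ext1 F n : 'rV[F]_n -> ext F^o n 1).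
Proof. by move=> c u v; apply: ext1D. Qed.

Lemma mem_ext1space A (x : ext F^o n 1) :
  x \in ext1space A <-> exists2 u, u \in A & x = ext1 u.
Proof.
have -> : ext1space A = (linfun (@ext1 F n : _ -> ext F^o n 1) @: A)%VS.
  rewrite -[in RHS](span_basis (vbasisP A)) limg_span; congr <<_>>%VS.
  by apply: eq_map => v; rewrite (linfunE ext1_linear).
split=> [/memv_imgP[u uA ->]|[u uA ->]].
  by exists u => //; rewrite (linfunE ext1_linear).
by apply/memv_imgP; exists u; rewrite ?(linfunE ext1_linear).
Qed.

Lemma wedge_eone_l k (x : ext F n k) : wedge (eone F n) x = x.
Proof. by apply: (@emb_inj _ _ k); apply: (etrans (emb_wedge (eone F n) x)); apply: emul1l. Qed.

Lemma emb_wedge_eone_r k (x : ext F n k) : emb (wedge x (eone F n)) = emb x.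
Proof. by rewrite emb_wedge emul1r. Qed.

Definition set0_ksub : ksub n 0 := exist _ set0 (introT eqP (cards0 _)).

Lemma ext0E (c : ext F n 0) : c = c set0_ksub *: (eone F n : ext F^o n 0) :> ext F^o n 0.
Proof.
apply/ffunP => S; rewrite !ffunE /GRing.scale /= mulr1; congr (c _).
by apply: val_inj; apply/eqP; rewrite /= -cards_eq0 (valP S).
Qed.

Lemma wedge_ext0l k (c : ext F n 0) (x : ext F n k) :
  wedge c x = c set0_ksub *: (x : ext F^o n k) :> ext F^o n k.
Proof.
apply/ffunP => S; have := wedgeDl (c set0_ksub) (eone F n) 0 x S.
by rewrite addr0 -ext0E wedge_eone_l wedge0l !ffunE addr0.
Qed.

(** The degree [k + 0] does not reduce to [k] for a variable [k], so the indices are matched by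
    their underlying sets instead of a cast. *)
Lemma wedge_ext0r k (c : ext F n 0) (x : ext F n k) (S : ksub n (k + 0)) (T : ksub n k) :
  val S = val T -> wedge x c S = c set0_ksub * x T.
Proof.
move=> ST; have := wedgeDr (c set0_ksub) x (eone F n) 0 S.
rewrite addr0 -ext0E wedge0r [(0 : ext _ _ _) S]ffunE addr0 => ->; congr (_ * _).
by rewrite -emb_val emb_wedge_eone_r ST emb_val.
Qed.

(** A linear condition on a span of products need only be tested on products. Keeping [phi] general
    allows the principle to be iterated underneath an outer wedge factor. *)
Lemma extpow_ind (A : {vspace 'rV[F]_n}) k (V : vectType F) (phi : ext F^o n k.+1 -> V)
    (E : {vspace V}) : linear phi ->
  (forall u a, u \in A -> a \in extpow A k ->
    phi (wedge (ext1 u) (a : ext F n k) : ext F n k.+1) \in E) ->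
  {in extpow A k.+1, forall a, phi a \in E}.
Proof.
move=> pL AE; apply: linear_span_sub => // _ /allpairsP[[x a] /= [xA aA ->]].
have /mem_ext1space[u uA ->] : x \in ext1space A by apply: vbasis_mem.
by apply: AE => //; apply: vbasis_mem.
Qed.

Lemma extpow1 A : extpow A 1 = ext1space A :> {vspace ext F^o n 1}.
Proof.
apply/eqP; rewrite eqEsubv; apply/andP; split; apply/subvP => x.
  apply: (extpow_ind (phi := id)) => // u c uA _.
  have -> : (wedge (ext1 u) (c : ext F n 0) : ext F^o n 1) =
      (c : ext F n 0) set0_ksub *: (ext1 u : ext F^o n 1).
    by apply/ffunP => S; rewrite [RHS]ffunE; apply: wedge_ext0r.
  by apply/memvZ/mem_ext1space; exists u.
move=> xA; have -> : x = wedge (x : ext F n 1) (eone F n) :> ext F n 1.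
  by apply: (@emb_inj _ _ 1); rewrite -(emb_wedge_eone_r (x : ext F n 1)).
by apply: (mem_wedgev (k := 1) (l := 0) (A := ext1space A)); rewrite ?memvf.
Qed.

Lemma wedge_linear_l k l (b : ext F n l) :
  linear (fun a : ext F^o n k => wedge (a : ext F n k) b : ext F^o n (k + l)).
Proof. by move=> c a a'; apply/ffunP => S; rewrite wedgeDl !ffunE. Qed.

Lemma wedge_linear_r k l (a : ext F n k) :
  linear (fun b : ext F^o n l => wedge a (b : ext F n l) : ext F^o n (k + l)).
Proof. by move=> c b b'; apply/ffunP => S; rewrite wedgeDr !ffunE. Qed.

Lemma extpow2_ind (A : {vspace 'rV[F]_n}) (V : vectType F) (phi : ext F^o n 2 -> V)
    (E : {vspace V}) : linear phi ->
  (forall u v, u \in A -> v \in A -> phi (wedge (ext1 u) (ext1 v) : ext F n 2) \in E) ->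
  {in extpow A 2, forall a, phi a \in E}.
Proof.
move=> pL AE; apply: extpow_ind => // u a uA.
by rewrite extpow1 => /mem_ext1space[v vA ->]; apply: AE.
Qed.

Lemma extpow3_ind (A : {vspace 'rV[F]_n}) (V : vectType F) (phi : ext F^o n 3 -> V)
    (E : {vspace V}) : linear phi ->
  (forall u v w, u \in A -> v \in A -> w \in A -> phi (wedge3 u v w) \in E) ->
  {in extpow A 3, forall a, phi a \in E}.
Proof.
move=> pL AE; apply: extpow_ind => // u a uA aA.
apply: (extpow2_ind (A := A)
  (phi := fun a => phi (wedge (ext1 u) (a : ext F n 2) : ext F n 3))) aA => [c x y|v w vA wA].
  by rewrite -pL; congr phi; apply: (@wedge_linear_r 1 2 (ext1 u) c x y).
by have := AE u v w uA vA wA; rewrite wedge3r.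
Qed.

(** Membership of the [r]-th factor of a decomposable trivector whose first [p]
    factors lie in [A] and whose others lie in [B]. *)
Definition slot (A B : {vspace 'rV[F]_n}) (p r : nat) := if (r < p)%N then A else B.

Lemma pqspace_le (A B : {vspace 'rV[F]_n}) p q (e : (p + q = 3)%N) (E : {vspace ext F^o n 3}) :
  (forall u v w, u \in slot A B p 0 -> v \in slot A B p 1 -> w \in slot A B p 2 ->
    (wedge3 u v w : ext F^o n 3) \in E) ->
  (pqspace A B e <= E)%VS.
Proof.
move=> slots.
have p3 : (p <= 3)%N by lia.
have qE : q = (3 - p)%N by lia.
(* For each numeral [p] the sum [p + (3 - p)] computes to 3, so [e] is a reflexivity proof and the
   cast in [pqspace] disappears. *)
move: qE e => ->; case: p p3 slots => [|[|[|[|//]]]] _ slots e;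
  rewrite (eq_irrelevance e erefl) /pqspace /=.
- apply: (wedgev_le (k := 0) (l := 3) (A := extpow A 0) (B := extpow B 3)) => a b _ bB.
  have -> : (wedge (a : ext F n 0) (b : ext F n 3) : ext F^o n 3) =
      (a : ext F n 0) set0_ksub *: b.
    exact: (wedge_ext0l (k := 3)).
  by apply: memvZ; apply: (extpow3_ind (phi := id)) bB.
- apply: (wedgev_le (k := 1) (l := 2) (A := extpow A 1) (B := extpow B 2)) => a b.
  rewrite extpow1 => /mem_ext1space[u uA ->].
  apply: (extpow2_ind (A := B)
    (phi := fun b => wedge (ext1 u) (b : ext F n 2) : ext F^o n 3)) => [|v w vB wB].
    exact: (@wedge_linear_r 1 2 (ext1 u)).
  by have := slots u v w uA vB wB; rewrite wedge3r.
- apply: (wedgev_le (k := 2) (l := 1) (A := extpow A 2) (B := extpow B 1)) => a b aA.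
  rewrite extpow1 => /mem_ext1space[w wB ->]; move: a aA.
  apply: (extpow2_ind (A := A)
    (phi := fun a => wedge (a : ext F n 2) (ext1 w) : ext F^o n 3)) => [|u v uA vA].
    exact: (@wedge_linear_l 2 1 (ext1 w)).
  exact: slots.
- apply: (wedgev_le (k := 3) (l := 0) (A := extpow A 3) (B := extpow B 0)) => a b aA _.
  have -> : (wedge (a : ext F n 3) (b : ext F n 0) : ext F^o n 3) =
      (b : ext F n 0) set0_ksub *: a.
    by apply/ffunP => S; rewrite [RHS]ffunE; apply: (wedge_ext0r (k := 3)).
  by apply: memvZ; apply: (extpow3_ind (phi := id)) aA.
Qed.

Lemma ext1_in_extpow (A : {vspace 'rV[F]_n}) u : u \in A -> (ext1 u : ext F^o n 1) \in extpow A 1.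
Proof. by move=> uA; rewrite extpow1; apply/mem_ext1space; exists u. Qed.

Lemma wedge_ext1_in_extpow (A : {vspace 'rV[F]_n}) k u (a : ext F^o n k) :
  u \in A -> a \in extpow A k -> (wedge (ext1 u) (a : ext F n k) : ext F^o n k.+1) \in extpow A k.+1.
Proof.
move=> uA aA; apply: (mem_wedgev (k := 1) (A := ext1space A)) => //.
by apply/mem_ext1space; exists u.
Qed.

Lemma mem_pqspace (A B : {vspace 'rV[F]_n}) p q (e : (p + q = 3)%N) u v w :
  u \in slot A B p 0 -> v \in slot A B p 1 -> w \in slot A B p 2 ->
  (wedge3 u v w : ext F^o n 3) \in pqspace A B e.
Proof.
have p3 : (p <= 3)%N by lia.
have qE : q = (3 - p)%N by lia.
move: qE e => ->; case: p p3 => [|[|[|[|//]]]] _ e;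
  rewrite (eq_irrelevance e erefl) /pqspace /slot /= => uS vS wS.
- have -> : wedge3 u v w = wedge (eone F n) (wedge3 u v w) by rewrite (wedge_eone_l (k := 3)).
  apply: (mem_wedgev (k := 0) (l := 3)); first exact: memvf.
  by rewrite wedge3r; do 2?apply: wedge_ext1_in_extpow => //; apply: ext1_in_extpow.
- rewrite wedge3r; apply: (mem_wedgev (k := 1) (l := 2)); first exact: ext1_in_extpow.
  by apply: wedge_ext1_in_extpow => //; apply: ext1_in_extpow.
- apply: (mem_wedgev (k := 2) (l := 1)); last exact: ext1_in_extpow.
  by apply: wedge_ext1_in_extpow => //; apply: ext1_in_extpow.
- have -> : wedge3 u v w = wedge (wedge3 u v w) (eone F n).
    by apply: (@emb_inj _ _ 3); rewrite -(emb_wedge_eone_r (wedge3 u v w)).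
  apply: (mem_wedgev (k := 3) (l := 0)); last exact: memvf.
  by rewrite wedge3r; do 2?apply: wedge_ext1_in_extpow => //; apply: ext1_in_extpow.
Qed.

End WedgeSpaces.
(** * The antilinear map t in coordinates *)

Section HodgeStar.
Variables (F : fieldType) (cj : {rmorphism F -> F}).

Lemma card_setC3 (S : ksub 6 3) : #|~: val S| == 3.
Proof. by have := cardsC (val S); rewrite (eqP (valP S)) card_ord => /(@addnI 3 _ 3) ->. Qed.

Definition csub (S : ksub 6 3) : ksub 6 3 := exist _ (~: val S) (card_setC3 S).

Lemma csubK : involutive csub.
Proof. by move=> S; apply: val_inj; rewrite /= setCK. Qed.

Lemma setU_fullE (S T : ksub 6 3) : (val S :|: val T == setT) = (T == csub S).
Proof.
transitivity (~: val S == val T); last by rewrite eq_sym -val_eqE.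
rewrite [RHS]eqEcard (eqP (card_setC3 S)) (eqP (valP T)) leqnn andbT.
by rewrite -[~: _]setTD subDset -subTset.
Qed.

Lemma gamma_wedgeE (a b : ext F 6 3) :
  gamma (wedge a b : ext F 6 6) =
  \sum_S shuffle_sign F (val S) (~: val S) * (a S * b (csub S)).
Proof.
rewrite /gamma ffunE; apply: eq_bigr => S _.
by rewrite (big_pred1 (csub S)) // => T; rewrite /= -setU_fullE.
Qed.

Definition epsS (S : {set 'I_6}) : F := \prod_(i in S) eps F i.

Lemma hform_delta i j :
  hform cj (delta_mx 0 i) (delta_mx 0 j) = (i == j)%:R * eps F i.
Proof.
rewrite /hform (bigD1 i) //= big1 ?addr0 => [|k nk]; last first.
  by rewrite !mxE (negPf nk) andbF rmorph0 mulr0 mul0r.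
by rewrite !mxE !eqxx rmorph1 mulr1 mulrC.
Qed.

Lemma elt_in k (S : ksub 6 k) r : elt S r \in val S.
Proof. exact: enum_valP. Qed.

Lemma elt_inj k (S : ksub 6 k) : injective (elt S).
Proof. by move=> r s /enum_val_inj /cast_ord_inj. Qed.

Lemma elt_onto k (S : ksub 6 k) i : i \in val S -> exists r, elt S r = i.
Proof.
move=> iS; exists (cast_ord (eqP (valP S)) (enum_rank_in iS i)).
by rewrite /elt cast_ordK enum_rankK_in.
Qed.

Lemma prod_elt k (S : ksub 6 k) (f : 'I_6 -> F) : \prod_(r < k) f (elt S r) = \prod_(i in val S) f i.
Proof.
have -> : val S = [set elt S r | r in 'I_k].
  apply/setP => i; apply/idP/imsetP => [/elt_onto[r <-]|[r _ ->]]; last exact: elt_in.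
  by exists r.
by rewrite big_imset //= => r s _ _; apply: elt_inj.
Qed.

(** The e_S are orthogonal for the induced form: if S and T differ, an element of S outside T gives
    a zero row of the Gram matrix. *)
Lemma det_hform_bvec (S T : ksub 6 3) :
  \det (\matrix_(r < 3, s < 3) hform cj (bvec F S r) (bvec F T s)) =
  (S == T)%:R * epsS (val S).
Proof.
have [<-|nST] := eqVneq S T.
  rewrite mul1r (_ : \matrix_(_, _) _ = diag_mx (\row_r eps F (elt S r))).
    by rewrite det_diag; under eq_bigr do rewrite mxE; apply: prod_elt.
  apply/matrixP => r s; rewrite !mxE hform_delta (inj_eq (@elt_inj _ S)).
  by case: eqP => [->|]; rewrite ?mul1r ?mul0r.
have [r rT] : exists r, elt S r \notin val T.
  have : ~~ (val S \subset val T).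
    apply: contraNN nST => sST; rewrite -val_eqE eqEcard sST.
    by rewrite (eqP (valP S)) (eqP (valP T)).
  by case/subsetPn => i /elt_onto[r <-] nT; exists r.
rewrite mul0r (expand_det_row _ r) big1 // => s _; rewrite !mxE hform_delta.
by case: eqP => [E|]; rewrite ?mul0r //; move: rT; rewrite E elt_in.
Qed.

Lemma hform3E (a b : ext F 6 3) :
  hform3 cj a b = \sum_S epsS (val S) * (cj (a S) * b S).
Proof.
apply: eq_bigr => S _; rewrite (bigD1 S) //= big1 ?addr0 => [|T nT].
  by rewrite det_hform_bvec eqxx mul1r mulrC.
by rewrite det_hform_bvec eq_sym (negPf nT) mul0r mulr0.
Qed.

(** Found by solving [gamma (t a /\ b) = H~(a, b)] one coefficient at a time: a conjugate-linear
    Hodge star for the form of signature (3, 3). *)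
Definition tform (a : ext F 6 3) : ext F 6 3 :=
  [ffun U => shuffle_sign F (val U) (~: val U) * epsS (~: val U) * cj (a (csub U))].

Lemma shuffle_sign_sq n (S T : {set 'I_n}) : shuffle_sign F S T * shuffle_sign F S T = 1.
Proof. by rewrite /shuffle_sign -expr2 sqrr_sign. Qed.

Lemma gamma_tform (a b : ext F 6 3) :
  gamma (wedge (tform a) b : ext F 6 6) = hform3 cj a b.
Proof.
rewrite gamma_wedgeE hform3E (reindex_inj (inv_inj csubK)); apply: eq_bigr => S _.
by rewrite ffunE csubK !mulrA shuffle_sign_sq mul1r /= setCK.
Qed.

Lemma gamma_nondegenerate (a : ext F 6 3) :
  (forall b : ext F 6 3, gamma (wedge a b : ext F 6 6) = 0) -> a = 0.
Proof.
move=> a0; apply/ffunP => S; rewrite ffunE.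
(* Pairing with the basis trivector of the complement of S isolates, up to sign, the coefficient at
   S. *)
have := a0 [ffun T => (T == csub S)%:R]; rewrite gamma_wedgeE (bigD1 S) //= big1 ?addr0.
  rewrite ffunE eqxx mulr1 => /eqP; rewrite mulf_eq0 signr_eq0 => /eqP //.
move=> T nT; rewrite ffunE (inj_eq (inv_inj csubK)) (negPf nT) !mulr0 //.
Qed.

Lemma gamma_wedge_linear (a : ext F 6 3) :
  linear ((fun b => gamma (wedge a (b : ext F 6 3) : ext F 6 6)) : ext F^o 6 3 -> F^o).
Proof. by move=> c b b'; apply: (wedgeDr (l := 3)). Qed.

Lemma rhoE (a b : ext F 6 3) : rho F a b = gamma (wedge a b : ext F 6 6).
Proof.
rewrite /rho linfunE ?linfunE //; first exact: gamma_wedge_linear.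
move=> c x y; apply/lfunP => z; rewrite !lfunE /= !lfunE /=.
rewrite !linfunE; [|exact: gamma_wedge_linear..].
exact: (wedgeDl (k := 3)).
Qed.

Lemma hform3_linear a : linear (hform3 cj a : ext F^o 6 3 -> F^o).
Proof.
move=> c b b'; rewrite !hform3E scaler_sumr -big_split; apply: eq_bigr => S _ /=.
by rewrite !ffunE /GRing.scale /=; ring.
Qed.

Lemma hform3_suml (I : finType) (a : I -> F) (X : I -> ext F 6 3) (y : ext F 6 3) :
  hform3 cj (\sum_i a i *: (X i : ext F^o 6 3) : ext F^o 6 3) y =
  \sum_i cj (a i) * hform3 cj (X i) y.
Proof.
rewrite hform3E; under [RHS]eq_bigr => i _ do rewrite hform3E mulr_sumr.
rewrite exchange_big; apply: eq_bigr => S _; rewrite sum_ffunE.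
rewrite rmorph_sum mulr_suml mulr_sumr; apply: eq_bigr => i _.
by rewrite ffunE /GRing.scale /= rmorphM; ring.
Qed.

Lemma hform3_sumr (I : finType) (a : I -> F) (X : I -> ext F 6 3) (y : ext F 6 3) :
  hform3 cj y (\sum_i a i *: (X i : ext F^o 6 3) : ext F^o 6 3) =
  \sum_i a i * hform3 cj y (X i).
Proof.
by rewrite -(linfunE (hform3_linear y)) linear_sum; apply: eq_bigr => i _;
  rewrite linearZ /= (linfunE (hform3_linear y)).
Qed.

Lemma rho_suml (I : finType) (a : I -> F) (X : I -> ext F 6 3) (y : ext F 6 3) :
  rho F (\sum_i a i *: (X i : ext F^o 6 3)) y = \sum_i a i * rho F (X i) y.
Proof.
rewrite linear_sum sum_lfunE; apply: eq_bigr => i _.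
by rewrite linearZ /= scale_lfunE.
Qed.

Lemma rho_sumr (I : finType) (a : I -> F) (X : I -> ext F 6 3) (y : ext F 6 3) :
  rho F y (\sum_i a i *: (X i : ext F^o 6 3)) = \sum_i a i * rho F y (X i).
Proof. by rewrite linear_sum; apply: eq_bigr => i _; rewrite linearZ. Qed.

Lemma hform_conj (v w : 'rV[F]_6) : involutive cj -> cj (hform cj v w) = hform cj w v.
Proof.
move=> cjK; rewrite /hform rmorph_sum; apply: eq_bigr => i _.
rewrite !rmorphM cjK; suff -> : cj (eps F i) = eps F i by ring.
by rewrite /eps; case: ifP => _; rewrite ?rmorphN rmorph1.
Qed.

Lemma hform_orthogonal (a b c d : F) (v1 v2 w1 w2 : 'rV[F]_6) :
  hform cj v1 w2 = 0 -> hform cj v2 w1 = 0 ->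
  hform cj (a *: v1 + b *: v2) (c *: w1 + d *: w2) =
  cj a * c * hform cj v1 w1 + cj b * d * hform cj v2 w2.
Proof.
(* The added zeros give the last summands the shape [a *: u + v] that [hformDl] and [hformDr]
   expect. *)
move=> o12 o21; rewrite -[b *: v2]addr0 -[d *: w2]addr0 !hformDl !hformDr o12 o21.
have h0' w : hform cj 0 w = 0.
  by rewrite /hform big1 // => i _; rewrite mxE rmorph0 mulr0 mul0r.
have h0 v : hform cj v 0 = 0 by rewrite /hform big1 // => i _; rewrite mxE mulr0.
by rewrite !h0 !h0'; ring.
Qed.

(** [rho^-1] is a priori only a generalised inverse. Nondegeneracy makes [rho] injective, so it
    cancels once [tau a] is recognised as the image of [tform a]. *)
Lemma tmapE a : tmap cj a = tform a.
Proof.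
rewrite /tmap; have -> : tau cj a = rho F (tform a).
  apply/lfunP => b; rewrite rhoE gamma_tform /tau linfunE //.
  exact: hform3_linear.
refine (lker0_lfunK (f := rho F) _ (tform a)); apply/eqP/vspaceP => x; rewrite memv_ker memv0.
apply/eqP/eqP => [x0|->]; last by rewrite linear0.
by apply: gamma_nondegenerate => b; rewrite -rhoE x0 lfunE.
Qed.

Lemma epsS_setC (S : {set 'I_6}) : epsS S * epsS (~: S) = -1.
Proof.
have -> : epsS S * epsS (~: S) = \prod_i eps F i.
  rewrite [RHS](bigID (mem S)) /=; congr (_ * _).
  by apply: eq_bigl => i; rewrite inE.
by rewrite !big_ord_recl big_ord0 /eps /=; ring.
Qed.

(** Each of the 3 * 3 pairs of an element of S and one of its complement is an inversion in exactly
    one of the two orders, and 9 is odd. *)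
Lemma shuffle_sign_csub (S : ksub 6 3) :
  shuffle_sign F (val S) (~: val S) * shuffle_sign F (~: val S) (val S) = -1.
Proof.
rewrite !shuffle_signE -exprD [X in (_ + X)%N]exchange_big /= -big_split /=.
rewrite (eq_bigr (fun=> 3)) => [|i iS].
  by rewrite big_const iter_addn addn0 (eqP (valP S)) -signr_odd.
rewrite -big_split /= (eq_bigr (fun=> 1)) => [|j jS].
  by rewrite sum1_card (eqP (card_setC3 S)).
have [//|//|/val_inj ij] := ltngtP i j.
by move: jS; rewrite inE -ij iS.
Qed.

Lemma cj_shuffle_sign n (S T : {set 'I_n}) : cj (shuffle_sign F S T) = shuffle_sign F S T.
Proof. exact: rmorph_sign. Qed.

Lemma cj_epsS S : cj (epsS S) = epsS S.
Proof.
rewrite rmorph_prod; apply: eq_bigr => i _.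
by rewrite /eps; case: ifP; rewrite ?rmorph1 ?rmorphN1.
Qed.

(** Two signs -1 cancel, one from the nine reordered pairs and one from the three negative
    directions of the form; with an even number of negative directions the square would be -1. *)
Lemma tformK : involutive cj -> involutive tform.
Proof.
move=> cjK a; apply/ffunP => S; rewrite !ffunE csubK !rmorphM cjK cj_epsS cj_shuffle_sign /= setCK.
transitivity ((shuffle_sign F (val S) (~: val S) * shuffle_sign F (~: val S) (val S)) * (epsS (val S) * epsS (~: val S)) * a S).
  by ring.
by rewrite epsS_setC shuffle_sign_csub mulrNN !mul1r.
Qed.

(** Both candidates have the same [gamma] pairing with every [g b']; surjectivity of [g] extends
    this to every trivector, and nondegeneracy concludes. *)
Lemma tform_comm (g : ext F 6 3 -> ext F 6 3) (c : F) :
  (forall x y, rho F (g x) (g y) = c * rho F x y) ->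
  (forall x y, hform3 cj (g x) (g y) = c * hform3 cj x y) ->
  (forall b, exists b', g b' = b) ->
  forall x, tform (g x) = g (tform x).
Proof.
move=> rg hg sg x; apply/eqP; rewrite -subr_eq0; apply/eqP; apply: gamma_nondegenerate => b.
have [b' <-] := sg b; rewrite -rhoE linearB add_lfunE opp_lfunE rg !rhoE !gamma_tform.
by rewrite hg subrr.
Qed.

End HodgeStar.

(** Sesquilinearity reduces the claim to basis trivectors, whose pairing is a 3 by 3 Gram
    determinant with every entry scaled by [c]. *)
Lemma hform3_ext3map (F : numFieldType) (cj : {rmorphism F -> F})
    (g : 'rV[F]_6 -> 'rV[F]_6) (c : F) :
  (forall v w, hform cj (g v) (g w) = c * hform cj v w) ->
  forall x y, hform3 cj (ext3map g x) (ext3map g y) = c ^+ 3 * hform3 cj x y.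
Proof.
move=> gc x y; rewrite (ext3mapE g x) (ext3mapE g y) {2}(ext_evec x) {2}(ext_evec y).
rewrite !hform3_suml mulr_sumr; apply: eq_bigr => S _.
rewrite !hform3_sumr !mulr_sumr; apply: eq_bigr => T _.
pose wm (h : 'rV[F]_6 -> 'rV[F]_6) := \matrix_(r < 3, s < 3) hform cj
  (nth 0 [:: h (bvec F S ord0); h (bvec F S (lift ord0 ord0)); h (bvec F S ord_max)] r)
  (nth 0 [:: h (bvec F T ord0); h (bvec F T (lift ord0 ord0)); h (bvec F T ord_max)] s).
have Eg : hform3 cj (ext3map g (evec F S)) (ext3map g (evec F T)) = \det (wm g).
  apply: (etrans (congr2 (hform3 cj) (ext3map_evec g S) (ext3map_evec g T))).
  exact: hform3_wedge3.
have E1 : hform3 cj (evec F S) (evec F T) = \det (wm id).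
  apply: (etrans (congr2 (hform3 cj) (esym (wedge3_bvec F S)) (esym (wedge3_bvec F T)))).
  exact: hform3_wedge3.
have Em : wm g = c *: wm id.
  apply/matrixP => r s; rewrite !mxE -gc.
  by case: r => [[|[|[|//]]] ?]; case: s => [[|[|[|//]]] ?].
by rewrite Eg E1 Em detZ; ring.
Qed.
(** * The eigenspaces of t over Q, R and C *)

Section EisensteinField.
Variables (R : realType) (K : fieldExtType rat) (iota : {rmorphism K -> R[i]}) (omega : K).
Hypothesis omega3 : 3.-primitive_root omega.
Hypothesis gen : <<1; omega>>%VS = {:K}%VS.

Notation theta := (2 * omega + 1).

Lemma omega_sq : omega ^+ 2 = - omega - 1.
Proof.
have n1 : omega != 1.
  by apply/eqP => o1; have := prim_order_dvd omega3 1; rewrite expr1 o1 eqxx.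
have : (omega - 1) * (omega ^+ 2 + omega + 1) = 0.
  by transitivity (omega ^+ 3 - 1); [ring | rewrite (prim_expr_order omega3) subrr].
move/eqP; rewrite mulf_eq0 subr_eq0 (negPf n1) /= -addrA addr_eq0 => /eqP ->.
by rewrite opprD.
Qed.

Lemma theta_sq : theta ^+ 2 = - 3 :> K.
Proof.
transitivity (4 * omega ^+ 2 + 4 * omega + 1); first by ring.
by rewrite omega_sq; ring.
Qed.

Lemma theta_neq0 : theta != 0.
Proof.
rewrite -sqrf_eq0 theta_sq oppr_eq0.
by rewrite -(rmorph_nat (in_alg K)) fmorph_eq0.
Qed.

(** A complex number x + iy of square -3 has xy = 0, and y = 0 would give a negative real square.
    Thus either embedding of K sends theta to a purely imaginary number. *)
Lemma iota_theta : exists2 y : R, iota theta = Complex 0 y & y != 0.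
Proof.
have := congr1 iota theta_sq; rewrite rmorphXn rmorphN rmorph_nat.
case: (iota theta) => x y.
rewrite (_ : - 3%:R = Complex (- 3%:R) 0 :> R[i]); last first.
  by rewrite -(rmorph_nat (real_complex R)) -rmorphN.
rewrite expr2 => /eqP; rewrite eq_complex /= => /andP[/eqP re /eqP im].
have [y0|y0] := eqVneq y 0.
  move: re; rewrite y0 mulr0 subr0 -expr2 => re.
  by have := sqr_ge0 x; rewrite re oppr_ge0 lern0.
exists y => //; congr Complex.
move/eqP: im; rewrite [y * x]mulrC -mulr2n mulrn_eq0 /= mulf_eq0 (negPf y0) orbF.
by move/eqP.
Qed.

Lemma conj_iota_theta : conjc (iota theta) = - iota theta.
Proof. by have [y -> _] := iota_theta; rewrite /conjc /= -[RHS]/(Complex _ _) oppr0. Qed.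

Lemma complex_real_theta (z : R[i]) : exists a b : R,
  z = real_complex R a + real_complex R b * iota theta.
Proof.
have [y -> y0] := iota_theta; case: z => a b; exists a, (b / y).
by apply/eqP; rewrite eq_complex /= !mulr0 !mul0r subr0 addr0 add0r addr0 divfK ?eqxx.
Qed.

Lemma conjK_iota x : iota (conjK iota x) = conjc (iota x).
Proof. exact: conjKP omega3 gen x. Qed.

Fact conjK_additive : {morph conjK iota : x y / x - y}.
Proof. by move=> x y; apply: (fmorph_inj iota); rewrite rmorphB !conjK_iota !rmorphB. Qed.

Fact conjK_multiplicative : monoid_morphism (conjK iota).
Proof.
by split=> [|x y]; apply: (fmorph_inj iota); rewrite ?rmorphM !conjK_iota ?rmorphM ?rmorph1.
Qed.

(** Packed as a ring morphism, conjugation on K can instantiate the same [tform] as conjugation on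
    C. *)
Definition conjKr : {rmorphism K -> K} :=
  HB.pack (conjK iota) (GRing.isZmodMorphism.Build K K _ conjK_additive)
    (GRing.isMonoidMorphism.Build K K _ conjK_multiplicative).

Lemma conjK_involutive : involutive (conjK iota).
Proof. by move=> x; apply: (fmorph_inj iota); rewrite !conjK_iota conjcK. Qed.

Lemma conjK_theta : conjK iota theta = - theta.
Proof. by apply: (fmorph_inj iota); rewrite conjK_iota conj_iota_theta rmorphN. Qed.

Lemma conjK_scale a x : conjK iota (a *: x) = a *: conjK iota x.
Proof.
apply: (fmorph_inj iota); rewrite conjK_iota !iotaZ rmorphM conjK_iota; congr (_ * _).
exact: fmorph_rat.
Qed.

Lemma dim_eisenstein : \dim {:K} = 2%N.
Proof.
apply/anti_leq/andP; split.
  suff -> : {:K}%VS = <<[:: 1%R; omega]>>%VS by apply: dim_span.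
  apply/esym/eqP; rewrite eqEsubv subvf /=; apply/subvP => x _.
  have : x \in <<1; omega>>%VS by rewrite gen memvf.
  case/Fadjoin_polyP => p /polyOver1P[q ->] ->.
  have m1 : 1%R \in <<[:: 1%R; omega]>>%VS by rewrite memv_span // inE eqxx.
  have mo : omega \in <<[:: 1%R; omega]>>%VS by rewrite memv_span // !inE eqxx orbT.
  (* Horner induction: the relation omega^2 = - omega - 1 keeps the span of 1 and omega stable under
     multiplication by omega. *)
  elim/poly_ind: q => [|q c IH]; first by rewrite rmorph0 horner0 mem0v.
  rewrite rmorphD rmorphM /= map_polyX map_polyC hornerMXaddC memvD //; last exact: memvZ.
  rewrite span_cons span_seq1 in IH.
  case/memv_addP: IH => _ /vlineP[a ->] [_ /vlineP[b ->] ->].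
  rewrite mulrDl -!scalerAl mul1r -expr2 omega_sq.
  by rewrite memvD ?memvZ // memvB // memvN.
(* In dimension at most 1, theta would be rational and hence fixed by conjugation, which negates it
   although it is nonzero. *)
rewrite ltnNge; apply/negP => d1.
have : omega \in 1%VS.
  have /eqP -> : 1%VS == {:K}%VS by rewrite eqEdim subvf dimv1.
  exact: memvf.
case/vlineP => a E; have := conj_iota_theta.
have -> : iota theta = ratr (2 * a + 1).
  by rewrite E !rmorphD !rmorphM !rmorph1 !rmorph_nat iotaZ rmorph1 mulr1.
rewrite [conjc _]fmorph_rat => /oppr_eq_id /eqP.
have <- : iota theta = ratr (2 * a + 1).
  by rewrite E !rmorphD !rmorphM !rmorph1 !rmorph_nat iotaZ rmorph1 mulr1.
by rewrite fmorph_eq0 (negPf theta_neq0).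
Qed.

Lemma card_ksub63 : #|{: ksub 6 3}| = 20%N.
Proof.
have -> : 20%N = 'C(#|'I_6|, 3) by rewrite card_ord.
by rewrite card_sig -card_draws cardsE; apply: eq_card => S; rewrite !inE.
Qed.

Lemma dim_extK : \dim {: ext K 6 3} = 40%N.
Proof.
by rewrite dimvf /dim /= card_ksub63 -dimvf dim_eisenstein.
Qed.

Local Notation t := (tW iota).

Lemma tWE : t =1 tform conjKr.
Proof. by move=> w; apply: (tmapE conjKr). Qed.

Lemma tW_linear : linear t.
Proof.
move=> a u v; apply/ffunP => S; rewrite !tWE !ffunE rmorphD mulrDr; congr (_ + _).
by rewrite [conjKr _]conjK_scale -scalerAr.
Qed.

Lemma tW_involutive : involutive t.
Proof. by move=> w; rewrite !tWE; apply: tformK; apply: conjK_involutive. Qed.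

Definition mulW (c : K) (w : ext K 6 3) : ext K 6 3 := [ffun S => c * w S].

Lemma mulW_linear c : linear (mulW c).
Proof. by move=> a u v; apply/ffunP => S; rewrite !ffunE mulrDr scalerAr. Qed.

Lemma mulWA c d w : mulW c (mulW d w) = mulW (c * d) w.
Proof. by apply/ffunP => S; rewrite !ffunE mulrA. Qed.

Lemma mul1W w : mulW 1 w = w.
Proof. by apply/ffunP => S; rewrite !ffunE mul1r. Qed.

Lemma tW_mulW c w : t (mulW c w) = mulW (conjK iota c) (t w).
Proof.
apply/ffunP => S; rewrite !tWE !ffunE rmorphM.
by rewrite -[conjK iota c]/(conjKr c); ring.
Qed.

Lemma conjK_thetaV : conjK iota theta^-1 = - theta^-1.
Proof. by rewrite -[conjK iota _]/(conjKr _) fmorphV [conjKr _]conjK_theta invrN. Qed.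

(** Both eigenspaces are treated at once: [(-1) ^+ b] is the eigenvalue, and multiplication by theta
    flips [b]. *)
Definition Wsgn (b : bool) : {vspace ext K 6 3} := if b then Wminus iota else Wplus iota.

Lemma mem_Wsgn b w : (w \in Wsgn b) = (t w == (-1) ^+ b *: w).
Proof.
rewrite scaler_sign /Wsgn; case: b; rewrite memv_ker !lfunE /= !lfunE /= linfunE; try exact: tW_linear.
  by rewrite addr_eq0.
by rewrite !lfunE /= subr_eq0.
Qed.

Lemma Wsgn_mulW c b w : conjK iota c = - c -> w \in Wsgn b -> mulW c w \in Wsgn (~~ b).
Proof.
move=> cN; rewrite !mem_Wsgn tW_mulW cN => /eqP ->; apply/eqP/ffunP => S.
by rewrite !scaler_sign; case: b; rewrite !ffunE ?mulNr ?mulrN ?opprK.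
Qed.

Definition projW (b : bool) (w : ext K 6 3) : ext K 6 3 := 2^-1 *: (w + (-1) ^+ b *: t w).

Lemma projW_in b w : projW b w \in Wsgn b.
Proof.
rewrite mem_Wsgn /projW.
have tZ a u : t (a *: u) = a *: t u.
  by rewrite -[a *: u]addr0 tW_linear -[t 0](linfunE tW_linear) linear0 addr0.
have tD u v : t (u + v) = t u + t v by rewrite -[u]scale1r tW_linear !scale1r.
rewrite tZ tD tZ tW_involutive [X in _ == X]scalerA mulrC -scalerA.
by rewrite [in X in _ == X]scalerDr signrZK addrC.
Qed.

Lemma projW_sum b w : w = projW b w + projW (~~ b) w.
Proof.
rewrite -scalerDr addrACA -mulr2n signrN scaleNr subrr addr0 -scaler_nat scalerA.
by rewrite mulVf ?scale1r.
Qed.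

Lemma Wsgn_add : (Wplus iota + Wminus iota = fullv)%VS.
Proof.
apply/eqP; rewrite eqEsubv subvf /=; apply/subvP => w _.
by rewrite (projW_sum false w); apply: memv_add; apply: (projW_in _ w).
Qed.

Lemma Wsgn_direct : directv (Wplus iota + Wminus iota).
Proof.
apply/directv_addP/eqP; rewrite -subv0; apply/subvP => w.
rewrite memv_cap => /andP[]; rewrite -[Wplus _]/(Wsgn false) -[Wminus _]/(Wsgn true).
rewrite !mem_Wsgn expr0 scale1r scaleN1r => /eqP -> /eqP E.
rewrite memv0; move/eqP: E; rewrite -addr_eq0 -mulr2n -scaler_nat scaler_eq0.
by rewrite pnatr_eq0.
Qed.

Lemma dim_Wsgn_le b : (\dim (Wsgn b) <= \dim (Wsgn (~~ b)))%N.
Proof.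
pose f := linfun (mulW theta).
have fE : f =1 mulW theta := linfunE (mulW_linear theta).
rewrite -(limg_dim_eq (f := f)).
  apply/dimvS/subvP => _ /memv_imgP[w wW ->].
  by rewrite fE Wsgn_mulW // conjK_theta.
apply/eqP; rewrite -subv0; apply/subvP => w; rewrite memv_cap memv_ker fE memv0 => /andP[_ /eqP E].
by rewrite -[w]mul1W -(mulVf theta_neq0) -mulWA E; apply/eqP/ffunP => S; rewrite !ffunE mulr0.
Qed.

Lemma dim_Wsgn b : \dim (Wsgn b) = 20%N.
Proof.
have E : \dim (Wplus iota) = \dim (Wminus iota).
  by apply/anti_leq; rewrite (dim_Wsgn_le false) (dim_Wsgn_le true).
have D : \dim (Wplus iota) = 20%N.
  apply: double_inj; rewrite -[RHS]dim_extK -Wsgn_add (directvP Wsgn_direct) /= -E.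
  by rewrite -addnn.
by case: b; rewrite /Wsgn -?E D.
Qed.

(** * Extension of scalars of the eigenspaces to R and C *)

Notation C := R[i].

Lemma iotaW_mulW c w :
  iotaW iota (mulW c w) = iota c *: (iotaW iota w : ext C^o 6 3) :> ext C^o 6 3.
Proof. by apply/ffunP => S; rewrite !ffunE rmorphM. Qed.

(** [C] and [Rcomplex R] share their carrier but not their scalars; this identity is the passage
    between the two structures. *)
Lemma RcomplexZ (a : R) (z : Rcomplex R) : a *: z = real_complex R a * (z : C) :> C.
Proof. by case: z => x y; apply/eqP; rewrite eq_complex /= !mul0r subr0 addr0 !eqxx. Qed.

Lemma iotaW_scale (a : rat) w :
  iotaW iota (a *: w) = (ratr a : R) *: iotaW iota w.
Proof.
apply/ffunP => S; rewrite !ffunE iotaZ; apply/esym.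
by apply: (etrans (RcomplexZ _ _)); rewrite fmorph_rat.
Qed.

Lemma tens_dim (F : numFieldType) (V : {vspace ext K 6 3}) :
  \dim {: tens F (subvs_of V)} = \dim V.
Proof. by rewrite dimvf /dim /= mul1n dimvf. Qed.

Lemma dim_extC : \dim {: ext C^o 6 3} = 20%N.
Proof. by rewrite dimvf /dim /= card_ksub63 muln1. Qed.

Lemma natmap_img b w : (iotaW iota w : ext C^o 6 3) \in limg (natmap iota (Wsgn b)).
Proof.
have inU u : u \in Wsgn b -> (iotaW iota u : ext C^o 6 3) \in limg (natmap iota (Wsgn b)).
  move=> uU; apply/memv_imgP; exists (tensor (vsproj (Wsgn b) u) 1); rewrite ?memvf //.
  by rewrite natmapE scale1r /iotaSub vsprojK.
rewrite (projW_sum b w) iotaWD memvD //; first by apply/inU/projW_in.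
(* The component in the opposite eigenspace is theta^-1 times an element of this one, and over C the
   factor [iota theta^-1] is a mere scalar. *)
rewrite -[projW (~~ b) w]mul1W -(mulVf theta_neq0) -mulWA iotaW_mulW memvZ // inU //.
by have := Wsgn_mulW conjK_theta (projW_in (~~ b) w); rewrite negbK.
Qed.

Lemma limg_natmap b : limg (natmap iota (Wsgn b)) = fullv.
Proof.
apply/eqP; rewrite eqEsubv subvf /=; apply/subvP => y _.
rewrite (ext_evec (y : ext C 6 3)); apply: memv_suml => S _; apply: memvZ.
have -> : evec C S = iotaW iota [ffun T => (T == S)%:R].
  by apply/ffunP => T; rewrite !ffunE rmorph_nat.
exact: natmap_img.
Qed.

Lemma lker_natmap b : lker (natmap iota (Wsgn b)) == 0%VS.
Proof.
have := limg_ker_dim (natmap iota (Wsgn b)) fullv.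
rewrite limg_natmap dim_extC tens_dim dim_Wsgn capfv => /(@addIn 20%N _ 0%N) /eqP.
by rewrite dimv_eq0.
Qed.

Lemma natmap_bij b : bijective (natmap iota (Wsgn b)).
Proof.
exists (natmap iota (Wsgn b))^-1%VF; first exact/lker0_lfunK/lker_natmap.
by move=> y; rewrite limg_lfunVK // limg_natmap memvf.
Qed.

Lemma realizeE (U : vectType rat) (j : U -> ext (Rcomplex R) 6 3) x :
  realize j x = tens_ext j x.
Proof. by rewrite /realize linfunE //; apply: tens_ext_linear. Qed.

(** [realize] is [natmap] restricted to real coordinates, and so inherits its injectivity. *)
Lemma realize_natmap (V : {vspace ext K 6 3}) x :
  realize (@iotaSub _ _ iota V) x = natmap iota V (map_mx (real_complex R) x).
Proof.
rewrite realizeE /natmap linfunE; last exact: tens_ext_linear.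
apply/ffunP => S; rewrite /tens_ext !sum_ffunE.
elim/big_rec2: _ => // i y z _ E; congr (_ + _) => //.
by rewrite !ffunE; apply: (etrans (RcomplexZ _ _)); rewrite mxE.
Qed.

Lemma realize_inj b : injective (realize (@iotaSub _ _ iota (Wsgn b))).
Proof.
move=> x y E; apply: (map_mx_inj (f := real_complex R)).
by apply: (bij_inj (natmap_bij b)); rewrite -!realize_natmap E.
Qed.

Lemma tformR_linear :
  linear (tform (@conjc R) : ext (Rcomplex R) 6 3 -> ext (Rcomplex R) 6 3).
Proof.
move=> a x y; apply/ffunP => S; rewrite !ffunE.
set z := x (csub S); set z' := y (csub S); set c := _ * epsS _ _.
rewrite (_ : a *: z + z' = real_complex R a * (z : C) + (z' : C)); last by rewrite -RcomplexZ.
apply/esym; apply: (etrans (congr1 (fun u : C => u + _) (RcomplexZ a _))).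
have E (u v : C) : conjc (real_complex R a * u + v) = real_complex R a * conjc u + conjc v.
  rewrite (raddfD (@conjc R)); congr (_ + _).
  by apply: (etrans (rmorphM (@conjc R) _ _)); rewrite /= oppr0.
by apply: (etrans _ (congr1 (fun u : C => c * u) (esym (E z z')))); ring.
Qed.

Definition tR : 'End(ext (Rcomplex R) 6 3) :=
  linfun (tform (@conjc R) : ext (Rcomplex R) 6 3 -> ext (Rcomplex R) 6 3).

Lemma tRE x : tR x = tform (@conjc R) x.
Proof. exact: (linfunE tformR_linear). Qed.

Lemma tR_extension : tW_extension iota tR.
Proof.
move=> w; rewrite tRE tWE; apply/ffunP => S; rewrite !ffunE !rmorphM.
rewrite [iota (conjKr _)]conjK_iota; congr (_ * _ * _).
  by apply/esym/rmorph_sign.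
rewrite rmorph_prod; apply: eq_bigr => i _.
by rewrite /eps; case: ifP; rewrite ?rmorph1 ?rmorphN1.
Qed.

(** The vectors e_S and theta e_S of W span all trivectors over R, since 1 and the image of theta
    form a real basis of C. *)
Lemma iotaW_full (V : {vspace ext (Rcomplex R) 6 3}) :
  (forall w, iotaW iota w \in V) -> V = fullv.
Proof.
move=> wV; apply/eqP; rewrite eqEsubv subvf /=; apply/subvP => y _.
have -> : y = \sum_S [ffun T => if T == S then y S else 0].
  apply/ffunP => T; rewrite sum_ffunE (bigD1 T) //= ffunE eqxx big1 ?addr0 // => S nS.
  by rewrite ffunE eq_sym (negPf nS).
apply: memv_suml => S _.
have [a [c E]] := complex_real_theta (y S : C).
pose e : ext K 6 3 := [ffun T => (T == S)%:R].
have -> : [ffun T => if T == S then y S else 0] =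
    a *: iotaW iota e + c *: iotaW iota (mulW theta e).
  apply/ffunP => T; rewrite !ffunE.
  apply/esym; apply: (etrans (congr2 (fun u v : C => u + v) (RcomplexZ _ _) (RcomplexZ _ _))).
  by rewrite rmorphM rmorph_nat; case: eqP => _; rewrite ?mulr1 ?mulr0 ?addr0 // -E.
by rewrite memvD ?memvZ.
Qed.

Lemma tR_unique : unique (tW_extension iota) tR.
Proof.
split=> [|s sE]; first exact: tR_extension.
suff E : lker (tR - s) = fullv.
  apply/lfunP => x; have : x \in lker (tR - s) by rewrite E memvf.
  by rewrite memv_ker !lfunE /= !lfunE /= subr_eq0 => /eqP.
apply: iotaW_full => w.
by rewrite memv_ker !lfunE /= !lfunE /= subr_eq0 sE tR_extension.
Qed.

Lemma mem_realspan b y :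
  (y \in realspan iota (Wsgn b)) = (tR y == (-1) ^+ b *: y).
Proof.
apply/idP/idP => [|yE].
  have : (realspan iota (Wsgn b) <= lker (tR - (-1) ^+ b *: \1%VF))%VS.
    apply/subvP => _ /memv_imgP[x _ ->]; rewrite realizeE; apply: memv_suml => i _.
    apply: memvZ; rewrite memv_ker !lfunE /= !lfunE /= !lfunE /= subr_eq0 tR_extension.
    have := subvsP (vbasis {: subvs_of (Wsgn b)})`_i; rewrite mem_Wsgn => /eqP ->.
    by rewrite iotaW_scale rmorph_sign id_lfunE.
  by move/subvP => sub /sub; rewrite memv_ker !lfunE /= !lfunE /= !lfunE /= id_lfunE subr_eq0.
(* This projector fixes [y] and sends W into [Wsgn b]; as W spans over R, its whole image lies in
   the real span. *)
pose P : 'End(ext (Rcomplex R) 6 3) := 2^-1 *: (\1%VF + (-1) ^+ b *: tR).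
have PE x : P x = 2^-1 *: (x + (-1) ^+ b *: tR x) by rewrite scale_lfunE add_lfunE scale_lfunE id_lfunE.
have -> : y = P y.
  rewrite PE (eqP yE) signrZK -mulr2n -scaler_nat scalerA mulVf ?scale1r //.
  by rewrite pnatr_eq0.
have: y \in (P @^-1: realspan iota (Wsgn b))%VS.
  rewrite (_ : (P @^-1: _)%VS = fullv) ?memvf //; apply: iotaW_full => w.
  rewrite -memv_preim PE tR_extension.
  have -> : 2^-1 *: (iotaW iota w + (-1) ^+ b *: iotaW iota (t w)) = iotaW iota (projW b w).
    by rewrite /projW iotaW_scale iotaWD iotaW_scale fmorphV rmorph_nat rmorph_sign.
  apply/memv_imgP; exists (tensor (vsproj (Wsgn b) (projW b w)) 1); rewrite ?memvf //.
  rewrite realizeE tens_extE => [|u v|a u].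
  - by rewrite scale1r /iotaSub vsprojK // projW_in.
  - by rewrite /iotaSub linearD iotaWD.
  - by rewrite /iotaSub linearZ iotaW_scale.
by rewrite -memv_preim.
Qed.

End EisensteinField.
(** * Diagonalisation of h_3 *)

Lemma wedge3Z (F : comNzRingType) n (a b c : F) (u v w : 'rV[F]_n) :
  wedge3 (a *: u) (b *: v) (c *: w) = (a * b * c) *: (wedge3 u v w : ext F^o n 3) :> ext F^o n 3.
Proof.
apply/ffunP => S; rewrite [RHS]ffunE !wedge3E scaler_sumr; apply: eq_bigr => i _.
rewrite scaler_sumr; apply: eq_bigr => j _; rewrite scaler_sumr; apply: eq_bigr => k _.
by rewrite !mxE /GRing.scale /=; ring.
Qed.

(** Each linear equation lowers the dimension by at most one. *)
Lemma dim_bigcap_lker (F : fieldType) (V : vectType F) m (f : 'I_m -> 'Hom(V, F^o)) :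
  (\dim {:V} <= \dim (\bigcap_(i < m) lker (f i)) + m)%N.
Proof.
elim: m f => [|m IH] f; first by rewrite big_ord0 addn0.
rewrite big_ord_recr /=; set A := (\bigcap_(i < m) _)%VS.
have dA : (\dim {:V} <= \dim A + m)%N by apply: IH.
have dk : (\dim {:V} <= \dim (lker (f ord_max)) + 1)%N.
  rewrite -(limg_ker_dim (f ord_max) fullv) capfv leq_add2l.
  by apply: leq_trans (dimvS (subvf _)) _; rewrite dimvf.
have := dimv_sum_cap A (lker (f ord_max)).
have : (\dim (A + lker (f ord_max)) <= \dim {:V})%N by apply/dimvS/subvf.
move: dA dk; lia.
Qed.

(** The shape of h(z) = a + bJ with J = i p - i q written through the two projections; [s] is 1 on
    V_+ and -1 on V_-. *)
Lemma lfun_combE (F : fieldType) (V : vectType F) (a b c s : F) (p q : 'End(V)) v x y :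
  p v = x -> q v = y -> x - y = s *: v ->
  (a *: \1 + b *: (c *: p - c *: q))%VF v = (a + b * c * s) *: v.
Proof.
move=> <- <- E; rewrite add_lfunE !scale_lfunE id_lfunE add_lfunE opp_lfunE !scale_lfunE.
by rewrite -[X in b *: X]scalerBr E !scalerA -scalerDl.
Qed.

Section Geometry.
Variables (R : realType) (Vp : {vspace 'rV[R[i]]_6}).
Notation C := R[i].
Hypothesis dimVp : \dim Vp = 3%N.
Hypothesis pos : forall v, v \in Vp -> v != 0 -> 0 < hform (@conjc R) v v.

Lemma Vp_cap : (Vp :&: orthv Vp = 0)%VS.
Proof.
apply/eqP; rewrite -subv0; apply/subvP => v; rewrite memv_cap memv0 => /andP[vp vm].
apply/negPn/negP => v0; have := pos vp v0.
by have /memv_orthv/(_ v vp) -> := vm; rewrite ltxx.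
Qed.

(** At least 3, because three equations cut it out of C^6; at most 3, because positivity makes it
    meet V_+ trivially. *)
Lemma dim_orthv : \dim (orthv Vp) = 3%N.
Proof.
have := dim_bigcap_lker (fun i : 'I_(\dim Vp) =>
  linfun (hform (@conjc R) (vbasis Vp)`_i : _ -> C^o)).
rewrite -/(orthv Vp) dimVp dimvf /dim /= => ge.
have le6 : (\dim (Vp + orthv Vp) <= 6)%N.
  by apply: leq_trans (dimvS (subvf _)) _; rewrite dimvf.
rewrite (dimv_disjoint_sum Vp_cap) dimVp (leq_add2l 3 _ 3) in le6.
by apply/anti_leq; rewrite le6 -(leq_add2r 3 3).
Qed.

Lemma Vp_add : (Vp + orthv Vp = fullv)%VS.
Proof.
apply/eqP; rewrite eqEdim subvf (dimv_disjoint_sum Vp_cap) dimVp dim_orthv.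
by rewrite dimvf.
Qed.

Lemma adapted_basis : exists f : 6.-tuple 'rV[C]_6, [/\ basis_of fullv f,
  forall i, (i < 3)%N -> f`_i \in Vp & forall i, (3 <= i)%N -> f`_i \in orthv Vp].
Proof.
have s1 : size (vbasis Vp) = 3 by rewrite size_tuple.
have s2 : size (vbasis (orthv Vp)) = 3 by rewrite size_tuple dim_orthv.
have sz : size (vbasis Vp ++ vbasis (orthv Vp)) == 6 by rewrite size_cat s1 s2.
exists (Tuple sz); split=> [|i i3|i i3] /=.
- rewrite -Vp_add; apply: cat_basis; try exact: vbasisP.
  by apply/directv_addP/Vp_cap.
- by rewrite nth_cat s1 i3 vbasis_mem // mem_nth // s1.
- rewrite nth_cat s1 ltnNge i3 /=.
  have [i6|i6] := ltnP (i - 3) 3; first by rewrite vbasis_mem // mem_nth // s2.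
  by rewrite nth_default ?mem0v // s2.
Qed.

Lemma hmap_Vp z v : v \in Vp -> hmap Vp z v = z *: v.
Proof.
move=> vp.
have p1 : daddv_pi Vp (orthv Vp) v = v by apply: daddv_pi_id => //; apply: Vp_cap.
have p2 : daddv_pi (orthv Vp) Vp v = 0.
  apply: (addrI (daddv_pi Vp (orthv Vp) v)).
  by rewrite addr0 daddv_pi_add ?p1 ?Vp_cap // (subvP (addvSl _ _) _ vp).
have E : v - 0 = 1 *: v by rewrite scale1r subr0.
apply: (etrans (lfun_combE _ _ _ p1 p2 E)).
by congr (_ *: _); case: z => x y; apply/eqP; rewrite eq_complex /=; apply/andP; split; apply/eqP; ring.
Qed.

Lemma hmap_orthv z v : v \in orthv Vp -> hmap Vp z v = conjc z *: v.
Proof.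
move=> vm.
have cap : (orthv Vp :&: Vp = 0)%VS by rewrite capvC Vp_cap.
have p1 : daddv_pi (orthv Vp) Vp v = v by apply: daddv_pi_id.
have p2 : daddv_pi Vp (orthv Vp) v = 0.
  apply: (addrI (daddv_pi (orthv Vp) Vp v)).
  by rewrite addr0 daddv_pi_add ?p1 // (subvP (addvSl _ _) _ vm).
have E : 0 - v = -1 *: v by rewrite scaleN1r sub0r.
apply: (etrans (lfun_combE _ _ _ p2 p1 E)).
by congr (_ *: _); case: z => x y; apply/eqP; rewrite eq_complex /=; apply/andP; split; apply/eqP; ring.
Qed.

End Geometry.

(** * h_3 in a basis adapted to V_+ and its orthogonal *)

Section Diagonal.
Variables (R : realType) (Vp : {vspace 'rV[R[i]]_6}) (f : 6.-tuple 'rV[R[i]]_6).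
Notation C := R[i].
Hypothesis pos : forall v, v \in Vp -> v != 0 -> 0 < hform (@conjc R) v v.
Hypothesis f_basis : basis_of fullv f.
Hypothesis f_Vp : forall i, (i < 3)%N -> f`_i \in Vp.
Hypothesis f_Vm : forall i, (3 <= i)%N -> f`_i \in orthv Vp.

(** The change of basis is an endomorphism of C^6 itself, so [ext3map] carries it to trivectors. *)
Definition toV (u : 'rV[C]_6) : 'rV[C]_6 := \sum_i u 0 i *: f`_i.
Definition fromV (v : 'rV[C]_6) : 'rV[C]_6 := \row_i coord f i v.

Lemma toV_linear : linear toV.
Proof.
move=> a u v; rewrite /toV scaler_sumr -big_split; apply: eq_bigr => i _.
by rewrite !mxE scalerDl scalerA.
Qed.

Lemma fromV_linear : linear fromV.
Proof. by move=> a u v; apply/rowP => i; rewrite !mxE linearP. Qed.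

Lemma fromVK : cancel fromV toV.
Proof.
move=> v; rewrite [RHS](coord_basis f_basis (memvf v)).
by apply: eq_bigr => i _; rewrite mxE.
Qed.

Lemma toVK : cancel toV fromV.
Proof.
move=> u; apply/rowP => i; rewrite mxE coord_sum_free //.
exact: basis_free f_basis.
Qed.

Definition diagc (z : C) (i : 'I_6) : C := if (i < 3)%N then z else conjc z.
Definition lam (z : C) (S : {set 'I_6}) : C := \prod_(i in S) diagc z i.

Lemma hmap_toV z u : hmap Vp z (toV u) = toV (\row_i (diagc z i * u 0 i)).
Proof.
rewrite /toV linear_sum; apply: eq_bigr => i _; rewrite linearZ mxE mulrC -scalerA; congr (_ *: _).
rewrite /diagc; have [i3|i3] := ltnP i 3.
  by rewrite -(hmap_Vp pos) ?f_Vp.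
by rewrite -(hmap_orthv pos) ?f_Vm.
Qed.

Definition Diag (z : C) (a : ext C 6 3) : ext C 6 3 := [ffun S => lam z (val S) * a S].

Lemma Diag_linear z : linear (Diag z : ext C^o 6 3 -> ext C^o 6 3).
Proof.
move=> c a b; apply/ffunP => S; rewrite !ffunE /GRing.scale /=.
by rewrite mulrDr mulrCA.
Qed.

Lemma ext3map_diag z :
  ext3map (fun u : 'rV[C]_6 => \row_i (diagc z i * u 0 i)) =1 Diag z.
Proof.
apply: ext3map_ext => [|S]; first exact: Diag_linear.
have dE r : (\row_i (diagc z i * bvec C S r 0 i)) = diagc z (elt S r) *: bvec C S r.
  by apply/rowP => i; rewrite !mxE eqxx /=; case: eqP => [->|]; rewrite ?mulr0.
rewrite ext3map_evec !dE wedge3Z wedge3_bvec.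
have -> : diagc z (elt S ord0) * diagc z (elt S (lift ord0 ord0)) * diagc z (elt S ord_max) = lam z (val S).
  rewrite /lam -(prod_elt S) !big_ord_recl big_ord0 mulr1 mulrA.
  by congr (_ * _ * diagc _ (elt _ _)); apply: val_inj.
apply/ffunP => T; rewrite !ffunE /GRing.scale /=.
by case: eqP => [->|]; rewrite ?mulr0.
Qed.

Definition Lmap : ext C 6 3 -> ext C 6 3 := ext3map toV.
Definition Linv : ext C 6 3 -> ext C 6 3 := ext3map fromV.

Lemma LinvK : cancel Linv Lmap.
Proof.
move=> a; rewrite /Lmap /Linv ext3map_comp; last exact: toV_linear.
by rewrite (eq_ext3map (h := id)) ?ext3map_id //; apply: fromVK.
Qed.

Lemma LmapK : cancel Lmap Linv.
Proof.
move=> a; rewrite /Lmap /Linv ext3map_comp; last exact: fromV_linear.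
by rewrite (eq_ext3map (h := id)) ?ext3map_id //; apply: toVK.
Qed.

Lemma h3_Lmap z a : h3 Vp z (Lmap a) = Lmap (Diag z a).
Proof.
rewrite -[h3 Vp z _]/(ext3map (hmap Vp z) _) /Lmap ext3map_comp; last exact: linearP.
rewrite -ext3map_diag ext3map_comp; last exact: toV_linear.
by apply: eq_ext3map => u; apply: hmap_toV.
Qed.

Lemma h3E z a : h3 Vp z a = Lmap (Diag z (Linv a)).
Proof. by rewrite -h3_Lmap LinvK. Qed.

Definition first3 : {set 'I_6} := [set i : 'I_6 | (i < 3)%N].
Definition ptype (S : ksub 6 3) : nat := #|val S :&: first3|.

Lemma ptype_le3 S : (ptype S <= 3)%N.
Proof. by have := subset_leq_card (subsetIl (val S) first3); rewrite (eqP (valP S)). Qed.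

Lemma lamE z S : lam z (val S) = z ^+ ptype S * conjc z ^+ (3 - ptype S).
Proof.
rewrite /lam (big_setID first3) /=; congr (_ * _).
  rewrite -prodr_const; apply: eq_bigr => i; rewrite !inE => /andP[_ i3].
  by rewrite /diagc i3.
rewrite -[3%N in RHS](eqP (valP S)) -cardsD -prodr_const.
by apply: eq_bigr => i; rewrite !inE => /andP[/negPf i3 _]; rewrite /diagc i3.
Qed.

Lemma lamM z w S : lam (z * w) S = lam z S * lam w S.
Proof.
rewrite -big_split; apply: eq_bigr => i _; rewrite /diagc; case: ifP => // _.
exact: (rmorphM (@conjc R)).
Qed.

Lemma lam1 S : lam 1 S = 1.
Proof.
rewrite /lam big1 // => i _; rewrite /diagc; case: ifP => // _.
exact: (rmorph1 (@conjc R)).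
Qed.

(** The product over all six indices is the determinant of h(z). *)
Lemma lam_setC z S : lam z S * lam z (~: S) = (z * conjc z) ^+ 3.
Proof.
have -> : lam z S * lam z (~: S) = \prod_i diagc z i.
  rewrite [RHS](bigID (mem S)) /=; congr (_ * _).
  by apply: eq_bigl => i; rewrite inE.
by rewrite !big_ord_recl big_ord0 /diagc /=; ring.
Qed.

Lemma h3M z w a : h3 Vp (z * w) a = h3 Vp z (h3 Vp w a).
Proof.
rewrite !h3E LmapK; congr Lmap; apply/ffunP => S.
by rewrite !ffunE lamM mulrA.
Qed.

Lemma h3_1 a : h3 Vp 1 a = a.
Proof.
rewrite h3E -[RHS]LinvK; congr Lmap; apply/ffunP => S.
by rewrite !ffunE lam1 mul1r.
Qed.

Lemma h3VK z : z != 0 -> cancel (h3 Vp z^-1) (h3 Vp z).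
Proof. by move=> z0 a; rewrite -h3M divff // h3_1. Qed.

(** The test value [1 + i] separates the characters [z^p zbar^(3 - p)]. *)
Lemma conj_pow_neq k : (0 < k <= 3)%N -> Complex 1 1 ^+ k != conjc (Complex 1 1) ^+ k :> C.
Proof.
move=> /andP[k0 k3]; rewrite -(rmorphXn (@conjc R)) /=.
suff : complex.Im (Complex 1 1 ^+ k : C) != 0.
  case: (_ ^+ k) => x y /= y0; apply: contraNneq y0 => -[] /eqP.
  by rewrite -addr_eq0 -mulr2n mulrn_eq0.
(* The imaginary parts of (1 + i)^k for k = 1, 2, 3 are 1, 2, 2; the bound matters, as (1 + i)^4 =
   -4 is real. *)
case: k k0 k3 => [|[|[|[|]]]] // _ _; rewrite ?exprS expr0 /= ?(mulr0, mulr1, mul1r, subr0, addr0, add0r, subrr).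
- by rewrite oner_neq0.
- by rewrite -mulr2n pnatr_eq0.
- by rewrite addrC -mulr2n pnatr_eq0.
Qed.

Lemma conj_pow_inj p p' : (p <= 3)%N -> (p' <= 3)%N ->
  let z : C := Complex 1 1 in
  z ^+ p * conjc z ^+ (3 - p) = z ^+ p' * conjc z ^+ (3 - p') -> p = p'.
Proof.
move=> + + z; wlog le : p p' / (p <= p')%N => [W p3 p'3 E|p3 p'3 E].
  by have [le|/ltnW le] := leqP p p'; [apply: W | apply/esym/W].
have z0 : z != 0 by rewrite eq_complex /= oner_eq0.
have zc0 : conjc z != 0 by rewrite fmorph_eq0.
have [k0|k0] := posnP (p' - p); first by apply/eqP; rewrite eqn_leq le -subn_eq0 k0.
have /negP[] := conj_pow_neq (k := p' - p) ltac:(lia).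
(* Multiplying by the nonzero z^p zbar^(3 - p') turns the required equality of (p' - p)-th powers
   back into the assumption. *)
rewrite -/z; apply/eqP/esym; apply: (mulfI (expf_neq0 p z0)).
apply: (mulIf (expf_neq0 (3 - p') zc0)).
rewrite -exprD subnKC // -E -mulrA -exprD; congr (_ * _ ^+ _); lia.
Qed.

Lemma LmapZ c (y : ext C 6 3) :
  Lmap (c *: (y : ext C^o 6 3) : ext C^o 6 3) = c *: (Lmap y : ext C^o 6 3) :> ext C^o 6 3.
Proof. exact: ext3map_linearZ. Qed.

Lemma LinvZ c (y : ext C 6 3) :
  Linv (c *: (y : ext C^o 6 3) : ext C^o 6 3) = c *: (Linv y : ext C^o 6 3) :> ext C^o 6 3.
Proof. exact: ext3map_linearZ. Qed.

Definition of_type p (y : ext C 6 3) : Prop := forall S, Linv y S != 0 -> ptype S = p.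

(** From left to right the single value z = 1 + i suffices: there the eigenvalues of distinct types
    differ, so coordinates of any other type vanish. *)
Lemma h3_eigenP p q (y : ext C 6 3) : (p + q = 3)%N ->
  (forall z, z != 0 -> h3 Vp z y = (z ^+ p * conjc z ^+ q) *: (y : ext C^o 6 3)) <->
  of_type p y.
Proof.
move=> pq; have qE : q = (3 - p)%N by lia.
have p3 : (p <= 3)%N by lia.
rewrite {}qE; split=> [E S nz|E z z0].
  apply: conj_pow_inj => //; first exact: ptype_le3.
  have z0 : (Complex 1 1 : C) != 0 by rewrite eq_complex /= oner_eq0.
  rewrite -lamE; apply: (mulIf nz).
  have /(congr1 (fun a => Linv a S)) := E _ z0.
  by rewrite h3E LmapK ffunE => ->; rewrite LinvZ ffunE.
rewrite h3E -[in RHS](LinvK y) -[RHS]LmapZ; congr Lmap; apply/ffunP => S.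
rewrite !ffunE; have [->|/E pS] := eqVneq (Linv y S) 0; first by rewrite mulr0 scaler0.
by rewrite lamE pS.
Qed.

Definition type_part p (y : ext C 6 3) : ext C 6 3 :=
  Lmap [ffun S => if ptype S == p then Linv y S else 0].

Lemma type_part_of_type p y : of_type p (type_part p y).
Proof.
by move=> S; rewrite /type_part LmapK ffunE; have [|_] := eqVneq (ptype S) p; rewrite ?eqxx.
Qed.

Lemma Linv_sum (I : finType) (y : I -> ext C 6 3) S :
  Linv (\sum_i (y i : ext C^o 6 3) : ext C^o 6 3) S = \sum_i Linv (y i) S.
Proof.
rewrite /Linv -(linfunE (ext3map_linear fromV)) linear_sum sum_ffunE.
apply: eq_bigr => i _.
exact: (congr1 (fun a : ext C 6 3 => a S) (linfunE (ext3map_linear fromV) (y i))).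
Qed.

(** As an equivalence it supplies both existence and uniqueness of the Hodge decomposition. *)
Lemma type_decomposition (y : ext C 6 3) (c : 'I_4 -> ext C 6 3) :
  (forall p : 'I_4, of_type p (c p)) ->
  y = \sum_p (c p : ext C^o 6 3) :> ext C^o 6 3 <-> forall p : 'I_4, c p = type_part p y.
Proof.
move=> ct; split=> [E p|E]; apply: (can_inj LinvK); apply/ffunP => S.
  rewrite /type_part LmapK ffunE E Linv_sum (bigD1 p) //=.
  have off (r : 'I_4) : ptype S != r -> Linv (c r) S = 0.
    by move=> nr; apply/eqP; apply: contraNT nr => /ct ->.
  case: eqP => [pS|/eqP /off -> //]; rewrite big1 ?addr0 // => r nr; apply: off.
  by rewrite pS eq_sym.
rewrite Linv_sum; under eq_bigr => p _ do rewrite E /type_part LmapK ffunE.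
have lt4 : (ptype S < 4)%N by rewrite ltnS ptype_le3.
rewrite (bigD1 (Ordinal lt4)) //= eqxx big1 ?addr0 // => p np.
by rewrite eq_sym -[ptype S]/(val (Ordinal lt4)) val_eqE (negPf np).
Qed.

Lemma bvec_list (g : 'rV[C]_6 -> 'rV[C]_6) (S : ksub 6 3) r :
  g (bvec C S r) \in [:: g (bvec C S ord0); g (bvec C S (lift ord0 ord0)); g (bvec C S ord_max)].
Proof.
rewrite !inE; case: r => [[|[|[|//]]] r3]; apply/or3P;
  [constructor 1|constructor 2|constructor 3]; apply/eqP; congr (g (bvec C S _)); exact: val_inj.
Qed.

(** A 3-element set other than the complement of S meets S, so the two decomposable trivectors share
    a vector of the adapted basis. *)
Lemma rho_Lmap_evec (S T : ksub 6 3) : T != csub S ->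
  rho C (Lmap (evec C S)) (Lmap (evec C T)) = 0.
Proof.
move=> nT; apply: (etrans (rhoE _ _)).
apply: (etrans (congr2 (fun a b : ext C 6 3 => gamma (wedge a b : ext C 6 6))
  (ext3map_evec toV S) (ext3map_evec toV T))).
have [i iS iT] : exists2 i, i \in val S & i \in val T.
  have : ~~ (val T \subset ~: val S).
    apply: contraNN nT => sub; rewrite -val_eqE eqEcard sub /=.
    by rewrite (eqP (valP T)) (eqP (card_setC3 S)).
  by case/subsetPn => i iT; rewrite inE negbK => iS; exists i.
have [r rE] := elt_onto iS; have [s sE] := elt_onto iT.
have bE : bvec C S r = bvec C T s by rewrite /bvec rE sE.
rewrite (wedge_wedge3_shared (bvec_list toV S r)) /gamma ?ffunE //.
by rewrite bE bvec_list.
Qed.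

Lemma rho_h3 z x y : rho C (h3 Vp z x) (h3 Vp z y) = (z * conjc z) ^+ 3 * rho C x y.
Proof.
rewrite !h3E -{2}(LinvK x) -{2}(LinvK y); move: (Linv x) (Linv y) => a b.
rewrite /Lmap (ext3mapE toV (Diag z a)) (ext3mapE toV (Diag z b)) (ext3mapE toV a) (ext3mapE toV b).
rewrite !rho_suml mulr_sumr; apply: eq_bigr => S _.
rewrite !rho_sumr !mulr_sumr; apply: eq_bigr => T _.
have [->|nT] := eqVneq T (csub S); last by rewrite rho_Lmap_evec // !mulr0.
by rewrite -(lam_setC z (val S)) !ffunE /=; ring.
Qed.

(** The conjugate-linear slot contributes zbar on V_+ and z on V_-, the linear slot z and zbar;
    either way the factor is z zbar, and the cross terms vanish. *)
Lemma hform_hmap (dimVp : \dim Vp = 3%N) z (v w : 'rV[C]_6) :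
  hform (@conjc R) (hmap Vp z v) (hmap Vp z w) = z * conjc z * hform (@conjc R) v w.
Proof.
have dec (x : 'rV[C]_6) : exists2 x1, x1 \in Vp &
    exists2 x2, x2 \in orthv Vp & x = 1 *: x1 + 1 *: x2.
  have : x \in (Vp + orthv Vp)%VS by rewrite (Vp_add dimVp pos) memvf.
  by case/memv_addP => x1 ? [x2 ? ->]; exists x1 => //; exists x2; rewrite ?scale1r.
have [v1 v1p [v2 v2m ->]] := dec v; have [w1 w1p [w2 w2m ->]] := dec w.
have o x y : x \in Vp -> y \in orthv Vp -> hform (@conjc R) x y = 0.
  by move=> xp /memv_orthv/(_ x xp).
have o' x y : x \in Vp -> y \in orthv Vp -> hform (@conjc R) y x = 0.
  move=> xp ym; rewrite -(hform_conj (cj := @conjc R) _ _ (@conjcK R)) o //.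
  exact: (rmorph0 (@conjc R)).
have hD (x y : 'rV[C]_6) : x \in Vp -> y \in orthv Vp ->
    hmap Vp z (1 *: x + 1 *: y) = z *: x + conjc z *: y.
  move=> xp ym; rewrite !scale1r raddfD; congr (_ + _); first exact: (hmap_Vp pos).
  exact: (hmap_orthv pos).
have hO (a b c d : C) : hform (@conjc R) (a *: v1 + b *: v2) (c *: w1 + d *: w2) =
    conjc a * c * hform (@conjc R) v1 w1 + conjc b * d * hform (@conjc R) v2 w2.
  exact: (hform_orthogonal (cj := @conjc R) a b c d (o v1 w2 v1p w2m) (o' w1 v2 w1p v2m)).
have c1 : conjc 1 = 1 :> C by exact: (rmorph1 (@conjc R)).
rewrite !hD // !hO conjcK !c1.
ring.
Qed.

Lemma tform_h3 (dimVp : \dim Vp = 3%N) z x : z != 0 ->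
  tform (@conjc R) (h3 Vp z x) = h3 Vp z (tform (@conjc R) x).
Proof.
move=> z0; move: x; apply: (tform_comm (cj := @conjc R) (c := (z * conjc z) ^+ 3)).
- exact: rho_h3.
- exact: (hform3_ext3map (cj := @conjc R) (hform_hmap dimVp z)).
- by move=> b; exists (h3 Vp z^-1 b); apply: h3VK.
Qed.

(** * Dimensions of the eigenspaces and their description by wedge products *)

Definition typespace (p : nat) : {vspace ext C^o 6 3} :=
  (linfun (Lmap : ext C^o 6 3 -> ext C^o 6 3) @: coordspace C [pred S | ptype S == p])%VS.

Lemma LfunE y : linfun (Lmap : ext C^o 6 3 -> ext C^o 6 3) y = Lmap y.
Proof. exact: (linfunE (ext3map_linear toV)). Qed.

Lemma mem_typespace p (y : ext C^o 6 3) : y \in typespace p <-> of_type p y.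
Proof.
split=> [/memv_imgP[a /mem_coordspace aP ->] S|yP].
  by rewrite LfunE LmapK => nz; apply/eqP; apply: contraNT nz => /aP ->.
apply/memv_imgP; exists (Linv y : ext C^o 6 3); last by rewrite LfunE LinvK.
by apply/mem_coordspace => S; apply: contraNeq => /yP /eqP.
Qed.

(** S is determined by its parts inside and outside [first3], which are arbitrary subsets of sizes p
    and 3 - p of two 3-element sets. *)
Lemma card_ptype p : #|[pred S | ptype S == p]| = ('C(3, p) * 'C(3, 3 - p))%N.
Proof.
have c3 : #|first3| = 3%N.
  by rewrite -sum1_card; under eq_bigl do rewrite inE; rewrite big_mkcond !big_ord_recl big_ord0.
have c3' : #|~: first3| = 3%N by have := cardsC first3; rewrite c3 card_ord => /(@addnI 3 _ 3).
pose D : {set {set 'I_6} * {set 'I_6}} :=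
  setX [set A : {set 'I_6} | A \subset first3 & #|A| == p] [set B : {set 'I_6} | B \subset ~: first3 & #|B| == (3 - p)%N].
have -> : ('C(3, p) * 'C(3, 3 - p))%N = #|D| by rewrite cardsX !cards_draws c3 c3'.
pose h (S : ksub 6 3) := (val S :&: first3, val S :\: first3).
have h_inj : injective h.
  by move=> S T [E1 E2]; apply: val_inj; rewrite -(setID (val S) first3) E1 E2 setID.
rewrite -(card_image h_inj); apply: eq_card => -[A B]; apply/imageP/idP.
  move=> [S /eqP pS [-> ->]]; rewrite !inE subsetIr -/(ptype S) pS eqxx /=.
  rewrite cardsD -/(ptype S) pS (eqP (valP S)) eqxx andbT.
  by rewrite setDE subsetIr.
rewrite !inE /= => /andP[/andP[sA /eqP cA] /andP[sB /eqP cB]].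
have p3 : (p <= 3)%N by have := subset_leq_card sA; rewrite cA c3.
have dBf : [disjoint B & first3] by rewrite disjoints_subset.
have dAB : A :&: B = set0.
  by apply/eqP; rewrite setI_eq0 disjoint_sym; apply: disjointWr dBf.
have cS : #|A :|: B| == 3 by rewrite cardsU dAB cards0 cA cB subn0 subnKC.
have E1 : (A :|: B) :&: first3 = A.
  rewrite setIUl (setIidPl sA); suff -> : B :&: first3 = set0 by rewrite setU0.
  by apply/eqP; rewrite setI_eq0.
have E2 : (A :|: B) :\: first3 = B.
  rewrite setDUl; suff -> : A :\: first3 = set0.
    by rewrite set0U setDE (setIidPl sB).
  by apply/eqP; rewrite setD_eq0.
exists (exist _ (A :|: B) cS : ksub 6 3); first by rewrite inE /ptype /= E1 cA.
by rewrite /h /= E1 E2.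
Qed.

Lemma dim_typespace p : \dim (typespace p) = ('C(3, p) * 'C(3, 3 - p))%N.
Proof.
rewrite -card_ptype -(dim_coordspace C) limg_dim_eq //.
apply/eqP; rewrite -subv0; apply/subvP => y; rewrite memv_cap memv_ker memv0 => /andP[_ /eqP E].
apply/eqP; rewrite -[LHS]LmapK -LfunE E -[RHS]LmapK -[in RHS]LfunE linear0 //.
Qed.

Lemma hmap_slot z p r u : u \in slot Vp (orthv Vp) p r ->
  hmap Vp z u = (if (r < p)%N then z else conjc z) *: u.
Proof.
by rewrite /slot; case: ifP => _ uS; [apply: (hmap_Vp pos) | apply: (hmap_orthv pos)].
Qed.

(** Checked through eigenvalues rather than coordinates, since every factor is an eigenvector of
    h(z). *)
Lemma wedge3_of_type p q u v w : (p + q = 3)%N ->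
  u \in slot Vp (orthv Vp) p 0 -> v \in slot Vp (orthv Vp) p 1 ->
  w \in slot Vp (orthv Vp) p 2 -> of_type p (wedge3 u v w).
Proof.
move=> pq uS vS wS; apply/(h3_eigenP _ pq) => z _.
have hL : linear (hmap Vp z) by move=> c x y; apply: linearP.
apply: (etrans (ext3map_wedge3 hL u v w)).
rewrite (hmap_slot z uS) (hmap_slot z vS) (hmap_slot z wS) wedge3Z; congr (_ *: _).
have -> : q = (3 - p)%N by lia.
have : (p <= 3)%N by lia.
by case: p {pq uS vS wS} => [|[|[|[|//]]]] _ /=; ring.
Qed.

Lemma toV_delta i : toV (delta_mx 0 i) = f`_i.
Proof.
rewrite /toV (bigD1 i) //= mxE !eqxx scale1r big1 ?addr0 // => j nj.
by rewrite mxE (negPf nj) andbF scale0r.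
Qed.

Lemma f_slot p (i : 'I_6) r : ((i < 3)%N = (r < p)%N) -> f`_i \in slot Vp (orthv Vp) p r.
Proof.
rewrite /slot => <-; have [i3|i3] := ltnP i 3; first exact: f_Vp.
exact: f_Vm.
Qed.

(** Listing S in increasing order puts the indices below 3, hence the factors from V_+, first, as
    [slot] demands. *)
Lemma Lmap_evec_slots (S : ksub 6 3) : exists u v w,
  [/\ Lmap (evec C S) = wedge3 u v w, u \in slot Vp (orthv Vp) (ptype S) 0,
      v \in slot Vp (orthv Vp) (ptype S) 1 & w \in slot Vp (orthv Vp) (ptype S) 2].
Proof.
have [a [b [c [ab bc SE]]]] := ksub3P S.
have [Ea Eb Ec] := bvec_ksub3 C ab bc SE.
exists f`_a, f`_b, f`_c.
have pE : ptype S = ((a < 3) + (b < 3) + (c < 3))%N.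
  have na : a \notin [set b; c] by rewrite !inE negb_or -!val_eqE /= !neq_ltn ab (ltn_trans ab bc).
  have nb : b \notin [set c] by rewrite !inE -val_eqE /= neq_ltn bc.
  rewrite /ptype -sum1_card SE -setUA.
  rewrite (eq_bigl (fun i => (i \in a |: [set b; c]) && (i < 3)%N)) => [|i]; last by rewrite !inE.
  rewrite big_mkcondr /= big_setU1 //= big_setU1 //= big_set1.
  by case: ifP => _; case: ifP => _; case: ifP.
split; first by rewrite [LHS]ext3map_evec Ea Eb Ec !toV_delta.
- by apply: f_slot; rewrite pE; have := ab; have := bc; lia.
- by apply: f_slot; rewrite pE; have := ab; have := bc; lia.
- by apply: f_slot; rewrite pE; have := ab; have := bc; lia.
Qed.

Lemma typespace_pqspace p q (e : (p + q = 3)%N) :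
  typespace p = pqspace Vp (orthv Vp) e.
Proof.
apply/eqP; rewrite eqEsubv; apply/andP; split; last first.
  by apply: pqspace_le => u v w uS vS wS; apply/mem_typespace/(wedge3_of_type e).
apply/subvP => y /mem_typespace yp; rewrite -(LinvK y) /Lmap (ext3mapE toV).
apply: memv_suml => S _; have [->|/yp pS] := eqVneq (Linv y S) 0; first by rewrite scale0r mem0v.
apply: memvZ; have [u [v [w [E uS vS wS]]]] := Lmap_evec_slots S.
by rewrite [ext3map _ _]E; apply: mem_pqspace; rewrite -pS.
Qed.

End Diagonal.
(** * The Hodge structures *)

Section HodgeStructures.
Variables (R : realType) (K : fieldExtType rat) (iota : {rmorphism K -> R[i]}) (omega : K).
Variables (Vp : {vspace 'rV[R[i]]_6}) (f : 6.-tuple 'rV[R[i]]_6).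
Hypothesis omega3 : 3.-primitive_root omega.
Hypothesis gen : <<1; omega>>%VS = {:K}%VS.
Hypothesis dimVp : \dim Vp = 3%N.
Hypothesis pos : forall v, v \in Vp -> v != 0 -> 0 < hform (@conjc R) v v.
Hypothesis f_basis : basis_of fullv f.
Hypothesis f_Vp : forall i, (i < 3)%N -> f`_i \in Vp.
Hypothesis f_Vm : forall i, (3 <= i)%N -> f`_i \in orthv Vp.

Local Notation C := R[i].
Local Notation W b := (Wsgn iota b).
Local Notation N b := (natmap iota (W b)).
Local Notation rep b := (h3sub iota Vp (W b)).
Local Notation rz b := (realize (@iotaSub _ _ iota (W b))).

Lemma h3_linear z : linear (h3 Vp z : ext C^o 6 3 -> ext C^o 6 3).
Proof. exact: ext3map_linear. Qed.

Lemma ext_RcomplexZ (a : R) (x y : ext (Rcomplex R) 6 3) :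
  a *: x + y = real_complex R a *: (x : ext C^o 6 3) + (y : ext C^o 6 3) :> ext C 6 3.
Proof.
by apply/ffunP => S; rewrite !ffunE; apply: (congr1 (fun u : C => u + _)); apply: RcomplexZ.
Qed.

Lemma h3_Rlinear z : linear (h3 Vp z : ext (Rcomplex R) 6 3 -> ext (Rcomplex R) 6 3).
Proof.
move=> a x y; apply: (etrans (congr1 (h3 Vp z) (ext_RcomplexZ a x y))).
by apply: (etrans (h3_linear z _ _ _)); apply/esym/ext_RcomplexZ.
Qed.

Lemma h3_realspan b z x : z != 0 ->
  x \in realspan iota (W b) -> h3 Vp z x \in realspan iota (W b).
Proof.
move=> z0; rewrite !(mem_realspan iota omega3 gen) !tRE => /eqP E; apply/eqP.
apply: (etrans (tform_h3 pos f_basis f_Vp f_Vm dimVp x z0)).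
apply: (etrans (congr1 (h3 Vp z) E)).
by rewrite -[_ *: x]addr0 h3_Rlinear -[h3 Vp z 0](linfunE (h3_Rlinear z)) linear0 addr0.
Qed.

(** The generalised inverse in [h3rep] cancels only on the image of [realize]; stability of that
    image under [h3] makes the restriction genuine. *)
Lemma realize_rep b z x : z != 0 -> rz b (rep b z x) = h3 Vp z (rz b x).
Proof.
move=> z0.
have L : linear (fun x => (rz b)^-1%VF (h3 Vp z (rz b x))).
  by move=> a u v; rewrite -linearP; congr (_ _); rewrite linearP; apply: h3_Rlinear.
apply: (etrans (congr1 (rz b) (linfunE L x))).
by apply: limg_lfunVK; apply: h3_realspan => //; apply: memv_img; apply: memvf.
Qed.

Lemma natmap_rep b z (v : tens R (subvs_of (W b))) : z != 0 ->
  N b (map_mx (real_complex R) (rep b z v)) = h3 Vp z (N b (map_mx (real_complex R) v)) :> ext C 6 3.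
Proof.
move=> z0; apply: (etrans (esym (realize_natmap _ _))).
transitivity (h3 Vp z (rz b v)); first exact: realize_rep.
apply: (congr1 (h3 Vp z)); exact: realize_natmap.
Qed.

(** Both sides are C-linear in [x], so the real basis vectors suffice. This identity transfers Hodge
    pieces to eigenvectors of [h3]. *)
Lemma natmap_complexify b z x : z != 0 ->
  N b (complexify (rep b z) x) = h3 Vp z (N b x) :> ext C 6 3.
Proof.
move=> z0; rewrite {2}[x]row_sum_delta /complexify !linear_sum.
rewrite -(linfunE (h3_linear z)) linear_sum; apply: eq_bigr => i _.
rewrite !linearZ /= linfunE ?h3_linear //; last exact: h3_linear.
rewrite -(map_delta_mx (real_complex R)).
by apply: (congr1 (fun y : ext C^o 6 3 => x 0 i *: y)); apply: natmap_rep.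
Qed.

Lemma natmap_inj b : injective (N b).
Proof. exact: bij_inj (natmap_bij iota omega3 gen b). Qed.

Lemma hodge_pieceP b p q x : (p + q = 3)%N ->
  hodge_piece (rep b) p q x <-> of_type f p (N b x).
Proof.
move=> pq; rewrite -(h3_eigenP pos f_basis f_Vp f_Vm _ pq); split=> E z z0.
  by rewrite -natmap_complexify // E // linearZ.
by apply: (@natmap_inj b); rewrite natmap_complexify // E // linearZ.
Qed.

Lemma rep_Cstar b : Cstar_rep (rep b).
Proof.
split=> [|z w z0 w0]; apply/lfunP => x; apply: (realize_inj omega3 gen (b := b)).
  rewrite id_lfunE realize_rep ?oner_neq0 //; exact: (h3_1 pos f_basis f_Vp f_Vm).
have E : rz b (rep b z (rep b w x)) = h3 Vp (z * w) (rz b x).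
  transitivity (h3 Vp z (rz b (rep b w x))); first exact: realize_rep.
  transitivity (h3 Vp z (h3 Vp w (rz b x))).
    by apply: (congr1 (h3 Vp z)); apply: realize_rep.
  by apply/esym; apply: (h3M pos f_basis f_Vp f_Vm).
rewrite comp_lfunE E; apply: realize_rep; exact: mulf_neq0.
Qed.

Lemma rep_hodge b : hodge_structure 3 (rep b).
Proof.
split=> [|x]; first exact: rep_Cstar.
have [g gK Kg] := natmap_bij iota omega3 gen b.
have pq (p : 'I_4) : (p + (3 - p) = 3)%N by rewrite subnKC // -ltnS.
exists [ffun p : 'I_4 => g (type_part f p (N b x))]; split=> [|c [cp xE]].
  have cp (p : 'I_4) : of_type f p (N b (g (type_part f p (N b x)))).
    by rewrite Kg; apply: type_part_of_type.
  split=> [p|]; first by rewrite ffunE; apply: (@hodge_pieceP b p _ _ (pq p)).2.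
  apply: (@natmap_inj b); rewrite linear_sum.
  apply: (etrans ((type_decomposition f_basis _ cp).2 (fun p => Kg _))).
  by apply: eq_bigr => p _; rewrite ffunE.
apply/ffunP => p; rewrite ffunE; apply: (@natmap_inj b); rewrite Kg; apply/esym.
have := (type_decomposition f_basis (N b x) (c := fun p => N b (c p))
  (fun p => proj1 (@hodge_pieceP b p _ _ (pq p)) (cp p))).1; apply.
by rewrite {1}xE linear_sum.
Qed.

Lemma rep_hodge_number b p q : (p + q = 3)%N ->
  hodge_number (rep b) p q ('C(3, p) * 'C(3, 3 - p)).
Proof.
move=> pq; exists ((N b)^-1 @: typespace f p)%VS.
  have bijV : cancel (N b) (N b)^-1%VF by apply: lker0_lfunK; apply: (lker_natmap iota omega3 gen).
  have Vbij : cancel (N b)^-1%VF (N b).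
    by move=> y; rewrite limg_lfunVK // (limg_natmap iota omega3 gen) memvf.
  move=> x; rewrite (hodge_pieceP _ pq) -(mem_typespace f_basis).
  split=> [/memv_imgP[y yT ->]|xT]; first by rewrite Vbij.
  by apply/memv_imgP; exists (N b x); rewrite ?bijV.
rewrite limg_dim_eq ?(dim_typespace f_basis) //.
apply/eqP; rewrite -subv0; apply/subvP => y; rewrite memv_cap memv_ker memv0 => /andP[_ /eqP E].
have : N b ((N b)^-1%VF y) = y by rewrite limg_lfunVK // (limg_natmap iota omega3 gen) memvf.
by rewrite E linear0 => <-.
Qed.

Lemma pqspace_piece b p q (e : (p + q = 3)%N) y :
  y \in pqspace Vp (orthv Vp) e <-> exists2 x, hodge_piece (rep b) p q x & N b x = y.
Proof.
rewrite -(typespace_pqspace pos f_basis f_Vp f_Vm e) (mem_typespace f_basis).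
have [g gK Kg] := natmap_bij iota omega3 gen b.
split=> [yp|[x /(hodge_pieceP _ e) xp <-] //].
by exists (g y) => //; apply/(hodge_pieceP _ e); rewrite Kg.
Qed.

(** * Multiplication by theta as a morphism of Hodge structures *)

Definition mulhom b (c : K) : 'Hom(subvs_of (W b), subvs_of (W (~~ b))) :=
  linfun (fun w => vsproj (W (~~ b)) (mulW c (vsval w))).

Lemma mulhomE b c w : conjK iota c = - c -> vsval (mulhom b c w) = mulW c (vsval w).
Proof.
move=> cN; rewrite linfunE; last first.
  by move=> a u v; rewrite -linearP; congr (vsproj _ _); rewrite linearP mulW_linear.
by rewrite vsprojK // (Wsgn_mulW omega3 gen) // subvsP.
Qed.

(** Inside the trivectors over C the map becomes a complex scalar, which commutes with the C-linear
    [h3] and therefore preserves types. *)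
Lemma natmap_mulhom b c x : conjK iota c = - c ->
  natmap iota (W (~~ b)) (tens_map (mulhom b c) x) = iota c *: N b x.
Proof.
move=> cN; rewrite /tens_map /tens_ext linear_sum [in RHS]/natmap linfunE; last exact: tens_ext_linear.
rewrite scaler_sumr; apply: eq_bigr => i _; rewrite linearZ /= natmapE scale1r.
by rewrite /iotaSub mulhomE // iotaW_mulW !scalerA mulrC.
Qed.

Lemma mulhom_hodge b c : conjK iota c = - c ->
  hodge_morphism 3 (rep b) (rep (~~ b)) (mulhom b c).
Proof.
move=> cN p q pq x xp z z0; apply: (@natmap_inj (~~ b)).
rewrite natmap_complexify // natmap_mulhom // linearZ /= natmap_mulhom //.
have /(congr1 (N b)) := xp z z0; rewrite natmap_complexify // linearZ => E.
rewrite -(linfunE (h3_linear z)) linearZ /= linfunE; last exact: h3_linear.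
by rewrite E !scalerA mulrC.
Qed.

End HodgeStructures.

Theorem mainTheorem3 (R : realType) (K : fieldExtType rat) (omega : K)
  (iota : {rmorphism K -> R[i]}) (Vp : {vspace 'rV[R[i]]_6}) :
  3.-primitive_root omega ->
  <<1; omega>>%VS = {:K}%VS ->
  \dim Vp = 3%N ->
  (forall v, v \in Vp -> v != 0 -> 0 < hform (@conjc R) v v) ->
  let t := tW iota in
  let Wp := Wplus iota in
  let Wm := Wminus iota in
  let rp := h3sub iota Vp Wp in
  let rm := h3sub iota Vp Wm in
  [/\ forall w, t (t w) = w,
      (Wp + Wm)%VS = fullv, directv (Wp + Wm), \dim Wp = 20%N & \dim Wm = 20%N] /\
  [/\ exists2 tR : 'End(ext (Rcomplex R) 6 3), unique (tW_extension iota) tR &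
        forall z, z != 0 -> forall x, tR (h3 Vp z x) = h3 Vp z (tR x),
      forall z, z != 0 -> forall x,
        x \in realspan iota Wp -> h3 Vp z x \in realspan iota Wp,
      forall z, z != 0 -> forall x,
        x \in realspan iota Wm -> h3 Vp z x \in realspan iota Wm,
      hodge_structure 3 rp & hodge_structure 3 rm] /\
  (exists2 f : 'Hom(subvs_of Wp, subvs_of Wm),
     forall (w : subvs_of Wp) S, vsval (f w) S = (2 * omega + 1) * vsval w S &
     hodge_isomorphism 3 rp rm f) /\
  [/\ bijective (natmap iota Wp),
      forall (p q : nat) (e : (p + q = 3)%N) y,
        y \in pqspace Vp (orthv Vp) e <->
        exists2 x, hodge_piece rp p q x & natmap iota Wp x = y,
      calabi_yau_type 3 rp &
      [/\ hodge_number rp 3 0 1, hodge_number rp 2 1 9,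
          hodge_number rp 1 2 9 & hodge_number rp 0 3 1]].
Proof.
move=> omega3 gen dimVp pos t Wp Wm rp rm.
have [f [f_basis f_Vp f_Vm]] := adapted_basis dimVp pos.
have theta_conj := conjK_theta iota omega3 gen.
have theta_conjV := conjK_thetaV iota omega3 gen.
have number := rep_hodge_number iota omega3 gen dimVp pos f_basis f_Vp f_Vm false.
split; last split; last split.
- split; [exact: (tW_involutive iota omega3 gen) | exact: (Wsgn_add iota omega3 gen)
    | exact: (Wsgn_direct iota omega3 gen) | exact: (dim_Wsgn iota omega3 gen false)
    | exact: (dim_Wsgn iota omega3 gen true)].
- split.
  + exists (tR R); first exact: (tR_unique iota omega3 gen).
    move=> z z0 x; rewrite !tRE.
    exact: (tform_h3 pos f_basis f_Vp f_Vm dimVp x z0).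
  + move=> z z0 x; exact: (h3_realspan omega3 gen dimVp pos f_basis f_Vp f_Vm (b := false) z0).
  + move=> z z0 x; exact: (h3_realspan omega3 gen dimVp pos f_basis f_Vp f_Vm (b := true) z0).
  + exact: (rep_hodge iota omega3 gen dimVp pos f_basis f_Vp f_Vm false).
  + exact: (rep_hodge iota omega3 gen dimVp pos f_basis f_Vp f_Vm true).
- exists (mulhom iota false (2 * omega + 1)).
    move=> w S; rewrite [vsval _](mulhomE omega3 gen (b := false) w theta_conj).
    by rewrite ffunE.
  (* Conjugation also negates theta^-1, so multiplication by it maps W_- back to W_+. *)
  exists (mulhom iota true (2 * omega + 1)^-1); split.
  + move=> w; apply: val_inj; rewrite [LHS](mulhomE omega3 gen (b := true) _ theta_conjV).
    rewrite [vsval _](mulhomE omega3 gen (b := false) _ theta_conj) mulWA.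
    by rewrite mulVf ?mul1W // (theta_neq0 omega3).
  + move=> w; apply: val_inj; rewrite [LHS](mulhomE omega3 gen (b := false) _ theta_conj).
    rewrite [vsval _](mulhomE omega3 gen (b := true) _ theta_conjV) mulWA.
    by rewrite mulfV ?mul1W // (theta_neq0 omega3).
  + exact: (mulhom_hodge omega3 gen dimVp pos f_basis f_Vp f_Vm (b := false) theta_conj).
  + exact: (mulhom_hodge omega3 gen dimVp pos f_basis f_Vp f_Vm (b := true) theta_conjV).
- split; first exact: (natmap_bij iota omega3 gen false).
  + move=> p q e y; exact: (pqspace_piece iota omega3 gen dimVp pos f_basis f_Vp f_Vm false).
  + split; first exact: (rep_hodge iota omega3 gen dimVp pos f_basis f_Vp f_Vm false).
    exact: (number 3 0).
  + by split; [exact: (number 3 0) | exact: (number 2 1) | exact: (number 1 2) | exact: (number 0 3)].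
Qed.
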